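(* Let $p=\min(n,m)$. The function $v$ is convex on $B_{JX}(P_0)\subset\mathbb{U}\subset\mathbf{G}_{n,m}$, and $$\mathrm{Hess}(v)\ \ge\ v(2-v)\,g+\left(\frac{v-1}{p\,v\,(v^{2/p}-1)}+\frac{p+1}{p\,v}\right)dv\otimes dv$$ (as an inequality of quadratic forms on tangent spaces) at every point of $\{P\in\mathbb{U}: v(P)\le 2\}$.
   Context: $\mathbf{G}_{n,m}$ is the Grassmannian manifold of oriented $n$-dimensional subspaces of $\mathbb{R}^{n+m}$. Fix $P_0\in\mathbf{G}_{n,m}$, spanned by an oriented orthonormal basis $\varepsilon_1,\dots,\varepsilon_n$, and complete it by $\varepsilon_{n+1},\dots,\varepsilon_{n+m}$ to an orthonormal basis of $\mathbb{R}^{n+m}$. For $P\in\mathbf{G}_{n,m}$ with oriented orthonormal basis $e_1,\dots,e_n$ put $w(P)=\langle e_1\wedge\cdots\wedge e_n,\varepsilon_1\wedge\cdots\wedge\varepsilon_n\rangle=\det(\langle e_i,\varepsilon_j\rangle)$, and let $\mathbb{U}=\{P\in\mathbf{G}_{n,m}: w(P)>0\}$. Every $P\in\mathbb{U}$ is spanned by $\varepsilon_i+\sum_{\alpha} z_{i\alpha}\varepsilon_{n+\alpha}$, $1\le i\le n$, for a unique $n\times m$ matrix $Z=(z_{i\alpha})$, and $Z$ serves as a global coordinate on $\mathbb{U}$. The canonical metric on $\mathbf{G}_{n,m}$ is, on $\mathbb{U}$, $g=\mathrm{tr}\big((I_n+ZZ^T)^{-1}dZ\,(I_m+Z^TZ)^{-1}dZ^T\big)$;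 $\mathrm{Hess}$ denotes the Hessian with respect to the Levi-Civita connection of $g$. The Jordan angles between $P\in\mathbb{U}$ and $P_0$ are $\theta_1,\dots,\theta_p\in[0,\pi/2)$, $p=\min(n,m)$, where $\tan\theta_1,\dots,\tan\theta_p$ are the singular values of $Z$ (with multiplicity). Equivalently, $\cos^2\theta_\alpha$ are the eigenvalues of $W^TW$ with $W=(\langle e_i,\varepsilon_j\rangle)$, apart from $n-p$ additional eigenvalues equal to $1$. $B_{JX}(P_0)\subset\mathbb{U}$ is the set of $P$ such that the sum of any two Jordan angles between $P$ and $P_0$ (that is, $\theta_\alpha+\theta_\beta$ for $\alpha\ne\beta$) is less than $\pi/2$. The function $v:\mathbb{U}\to[1,\infty)$ is $v=w^{-1}=[\det(I_n+ZZ^T)]^{1/2}=\prod_\alpha\sec\theta_\alpha$. ''Convex'' means that the Hessian is nonnegative definite. At the only point with $v=1$, namely $P_0$, one has $dv=0$ and the quotient $(v-1)/(v^{2/p}-1)$ is understood as its limit $p/2$. *)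

(* Defs.v *)
From HB Require Import structures.
From mathcomp Require Import all_boot all_order all_algebra.
From mathcomp Require Import all_classical all_reals all_analysis.

Set Implicit Arguments.
Unset Strict Implicit.
Unset Printing Implicit Defensive.

Import Order.TTheory GRing.Theory Num.Theory.
Import numFieldNormedType.Exports.

Local Open Scope classical_set_scope.
Local Open Scope ring_scope.

(* Vectors of R^k are rows; the rows of E are the basis vectors. *)
Record onbasis (R : realType) (k : nat) := OnBasis {
  onmx :> 'M[R]_k ;
  onmxP : onmx *m onmx^T = 1%:M }.

Section Grassmannian.
Variables (R : realType) (n m : nat).

Definition oriented_bases (E : 'M[R]_(n, n + m)) : set 'M[R]_(n, n + m) :=
  [set F | exists A : 'M[R]_n, 0 < \det A /\ F = A *m E].

(* An oriented n-dimensional subspace of R^(n+m), encoded as the set of all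
   its positively oriented bases (one GL_n^+-orbit of rank n matrices). *)
Record grassmannian := Grassmannian {
  bases : set 'M[R]_(n, n + m) ;
  basesP : exists2 E, row_free E & bases = oriented_bases E }.

Definition oriented_onb (P : grassmannian) : set 'M[R]_(n, n + m) :=
  [set e | bases P e /\ e *m e^T = 1%:M].

Variable eps : onbasis R (n + m).

(* The matrix (<e_i, eps_j>) for j <= n; e is any oriented orthonormal basis
   of P, two of which differ by a matrix of determinant 1. *)
Definition w (P : grassmannian) : R :=
  \det (xget 0 (oriented_onb P) *m (usubmx (eps : 'M[R]_(n + m)))^T).

Definition U : set grassmannian := [set P | 0 < w P].

Definition v (P : grassmannian) : R := (w P)^-1.

(* Row i is eps_i + \sum_a Z i a *: eps_(n + a). *)
Definition graph_basis (Z : 'M[R]_(n, m)) : 'M[R]_(n, n + m) :=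
  row_mx 1%:M Z *m eps.

Lemma row_free_graph_basis Z : row_free (graph_basis Z).
Proof.
have eps_unit : (eps : 'M[R]_(n + m)) \in unitmx.
  by have [] := mulmx1_unit (onmxP eps).
rewrite /graph_basis /row_free mxrankMfree ?row_free_unit//.
apply/row_freeP; exists (col_mx 1%:M 0).
by rewrite mul_row_col mulmx0 addr0 mulmx1.
Qed.

Definition plane (Z : 'M[R]_(n, m)) : grassmannian :=
  @Grassmannian (oriented_bases (graph_basis Z))
    (ex_intro2 _ _ (graph_basis Z) (row_free_graph_basis Z) erefl).

(* The coordinate of P \in U, with inverse [plane]. *)
Definition coord (P : grassmannian) : 'M[R]_(n, m) :=
  xget 0 [set Z | bases P (graph_basis Z)].

End Grassmannian.

Section RiemannianGeometry.
Variables (R : realType) (n m : nat).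
Implicit Types (X Y Z : 'M[R]_(n, m)) (f : 'M[R]_(n, m) -> R).

Definition metric Z X Y : R :=
  \tr (invmx (1%:M + Z *m Z^T) *m X *m invmx (1%:M + Z^T *m Z) *m Y^T).

(* The coordinates z_(i, a) are numbered by 'I_(n * m) through mxvec. *)
Definition coord_vect (k : 'I_(n * m)) : 'M[R]_(n, m) := vec_mx (delta_mx 0 k).

Definition partial (k : 'I_(n * m)) f : 'M[R]_(n, m) -> R :=
  fun Z => 'D_(coord_vect k) f Z.

Definition gram Z : 'M[R]_(n * m) :=
  \matrix_(i, j) metric Z (coord_vect i) (coord_vect j).

(* Christoffel symbols of the Levi-Civita connection of [metric]. *)
Definition christoffel (k i j : 'I_(n * m)) Z : R :=
  2^-1 * \sum_l invmx (gram Z) k l *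
    (partial i (fun Z' => gram Z' j l) Z + partial j (fun Z' => gram Z' i l) Z
     - partial l (fun Z' => gram Z' i j) Z).

Definition hess_coord f Z X Y : R :=
  \sum_i \sum_j mxvec X 0 i * mxvec Y 0 j *
    (partial i (partial j f) Z - \sum_k christoffel k i j Z * partial k f Z).

End RiemannianGeometry.

Section HessianOnU.
Variables (R : realType) (n m : nat) (eps : onbasis R (n + m)).
Implicit Types (f : grassmannian R n m -> R) (P : grassmannian R n m).

(* For P \in U, tangent vectors at P are given by their components in the
   coordinate Z, i.e. as n x m matrices X = dZ(xi). *)
Definition g P (X Y : 'M[R]_(n, m)) : R := metric (coord eps P) X Y.

Definition d f P (X : 'M[R]_(n, m)) : R :=
  'D_X (f \o plane eps) (coord eps P).

Definition Hess f P (X Y : 'M[R]_(n, m)) : R :=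
  hess_coord (f \o plane eps) (coord eps P) X Y.

Definition convex_on (D : set (grassmannian R n m)) f :=
  forall P, D P -> forall X, 0 <= Hess f P X X.

End HessianOnU.

Section JordanAngles.
Variables (R : realType) (n m : nat).

(* The squares of the min(n, m) singular values are the eigenvalues of Z Z^T,
   with multiplicity, apart from n - min(n, m) additional zeros. *)
Definition singular_values (Z : 'M[R]_(n, m)) (s : 'I_(minn n m) -> R) :=
  (forall a, 0 <= s a) /\
  char_poly (Z *m Z^T) =
    'X^(n - minn n m) * \prod_(a < minn n m) ('X - (s a ^+ 2)%:P).

Variable eps : onbasis R (n + m).

Definition jordan_angles (P : grassmannian R n m) (theta : 'I_(minn n m) -> R) :=
  (forall a, 0 <= theta a < pi / 2) /\
  singular_values (coord eps P) (fun a => tan (theta a)).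

(* The Jordan angles exist and are unique up to order. *)
Definition B_JX : set (grassmannian R n m) :=
  [set P | U eps P /\ exists2 theta, jordan_angles P theta &
    forall a b, a != b -> theta a + theta b < pi / 2].

End JordanAngles.

(* (x - 1) / (x^(2/p) - 1), extended by its limit p / 2 at x = 1. *)
Definition vquot (R : realType) (p : nat) (x : R) : R :=
  if x == 1 then p%:R / 2 else (x - 1) / (x `^ (2 / p%:R) - 1).

(* Main.v *)
Require Import Defs.
From mathcomp Require Import all_boot all_order all_algebra perm.
From mathcomp Require Import all_classical all_reals all_analysis.
From mathcomp Require Import ring lra.

Set Implicit Arguments.
Unset Strict Implicit.
Unset Printing Implicit Defensive.

Import Order.TTheory GRing.Theory Num.Theory.
Import numFieldNormedType.Exports.

Local Open Scope ring_scope.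

(** Write [Z] for the coordinate of a plane, [A = (1 + Z Z^T)^-1],
    [B = (1 + Z^T Z)^-1] and [v = sqrt (det (1 + Z Z^T))].  Jacobi's formula gives
    [dv(X) = v * tr (A X Z^T)], and Koszul's formula shows that the Levi-Civita
    connection of the metric [tr (A X B Y^T)] is
    [- (X B Z^T Y + Y B Z^T X)].  After cancellations (lemma [hess_volE]),
      [Hess v (X, X) = v * (g (X, X) + (tr M)^2 + tr (M^2))],  [M = A X Z^T].

    By the spectral theorem, applied to [Z Z^T], one may assume that the rows of
    [Z] are orthogonal, of squared norms [e_i], the squared tangents of the Jordan
    angles completed by zeros.  Then there is a square matrix [r] with
    [tr M = \sum_i r_ii], [tr (M^2) = \sum_ij r_ij r_ji] and, by Bessel's
    inequality, [g (X, X) >= \sum_ij r_ij^2 / e_j] (lemma [diagonal_form]).  If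
    [e_i e_j <= c^2] whenever [i != j], the off-diagonal entries contribute a
    nonnegative amount to [c * g (X, X) + tr (M^2)] (lemma [diag_le_form]), so that
      [c * g (X, X) + tr (M^2) >= \sum_i (c / e_i + 1) * r_ii^2].

    On [B_JX] one may take [c = 1], because the product of the tangents of two
    angles of sum less than [pi / 2] is less than [1]; convexity follows.

    When [v <= 2], one may take [c = v - 1], because
    [v^2 >= (1 + e_i) (1 + e_j) >= (1 + sqrt (e_i e_j))^2].  The weighted
    Cauchy-Schwarz inequality bounds [(tr M)^2 = (\sum_i r_ii)^2] by the right-hand
    side above times [\sum_i e_i / (c + e_i)].  Since [c <= 1], the function
    [x |-> x / (c + x)] is concave in [ln (1 + x)]; as the product of the [1 + e_i]
    is [v^2] and at most [p] of the [e_i] are nonzero, the sum is largest when [p]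
    of them are equal (lemma [sum_bound]), and this value gives the coefficient of
    [dv^2]. *)

(** * Spectral theorem for real symmetric matrices *)

Lemma continuous_bigsum (R : realType) (T : topologicalType) (I : Type)
    (r : seq I) (f : I -> T -> R) :
  (forall i, continuous (f i)) -> continuous (fun x => \sum_(i <- r) f i x).
Proof.
by move=> cf; apply: continuous_big => // p; exact: (@add_continuous R^o).
Qed.

Lemma continuous_mul (R : realType) (T : topologicalType) (f g : T -> R) :
  continuous f -> continuous g -> continuous (fun x => f x * g x).
Proof. by move=> cf cg x; exact: continuousM (cf x) (cg x). Qed.

Lemma mulmx_trE (R : realType) k1 k2 l (M : 'M[R]_(k1, l)) (N : 'M[R]_(k2, l)) i j :
  (M *m N^T) i j = \sum_k M i k * N j k.
Proof. by rewrite mxE; apply: eq_bigr => k _; rewrite mxE. Qed.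

Section SpectralTheorem.
Variables (R : realType) (n : nat).
Implicit Types (O S T : 'M[R]_n).

Lemma orthomx_le1 O i j : O *m O^T = 1%:M -> `|O i j| <= 1.
Proof.
move=> /matrixP/(_ i i); rewrite !mxE eqxx (bigD1 j)//= !mxE => Oi.
rewrite -(@ler_pXn2r _ 2)// ?nnegrE// expr1n real_normK ?num_real// expr2.
by rewrite -[leRHS]Oi lerDl sumr_ge0// => k _; rewrite mxE -expr2 sqr_ge0.
Qed.

(* The orthogonal group, as a subset of [R ^ (n * n)], where closed bounded
   sets are compact. *)
Let orthoset : set 'rV[R]_(n * n) :=
  [set u | vec_mx u *m (vec_mx u)^T = 1%:M]%classic.

Let entry_continuous i j : continuous (fun u : 'rV[R]_(n * n) => vec_mx u i j).
Proof.
have -> : (fun u : 'rV[R]_(n * n) => vec_mx u i j) = fun u => u 0 (mxvec_index i j).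
  by apply/funext => u; rewrite mxE.
exact: coord_continuous.
Qed.

Let orthoset_compact : compact orthoset.
Proof.
apply: bounded_closed_compact.
  exists 1; split; first exact: num_real.
  move=> x x1 u /= Ou; rewrite /Num.Def.normr/= mx_normrE.
  apply: bigmax_le => [|[i k] _ /=]; first by rewrite (le_trans _ (ltW x1)).
  rewrite (le_trans _ (ltW x1))// ord1 -[u]vec_mxK.
  by case/mxvec_indexP: k => a b; rewrite mxvecE orthomx_le1.
have -> : orthoset = (\bigcap_(ij in [set: 'I_n * 'I_n])
    (fun u : 'rV[R]_(n * n) => \sum_k vec_mx u ij.1 k * vec_mx u ij.2 k) @^-1`
      [set ((ij.1 == ij.2)%:R : R)])%classic.
  apply/seteqP; split => u /=.
    by move=> Ou [i j] _ /=; rewrite -mulmx_trE Ou mxE.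
  move=> Ou; apply/matrixP => i j; have /= := Ou (i, j) Logic.I.
  by rewrite mulmx_trE mxE => ->.
apply: closed_bigI => -[i j] _; apply: preimage_closed => /= [u _|].
  move: u; apply: continuous_bigsum => k.
  by apply: continuous_mul; exact: entry_continuous.
exact: closed_eq.
Qed.

(** The bilinear form of matrix [T] on row vectors. *)
Definition mxform T (x y : 'rV[R]_n) : R := (x *m T *m y^T) 0 0.

Lemma mxformDl T x x' y : mxform T (x + x') y = mxform T x y + mxform T x' y.
Proof. by rewrite /mxform !mulmxDl mxE. Qed.

Lemma mxformZl T a x y : mxform T (a *: x) y = a * mxform T x y.
Proof. by rewrite /mxform -!scalemxAl mxE. Qed.

Lemma mxformDr T x y y' : mxform T x (y + y') = mxform T x y + mxform T x y'.
Proof. by rewrite /mxform linearD mulmxDr mxE. Qed.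

Lemma mxformZr T a x y : mxform T x (a *: y) = a * mxform T x y.
Proof. by rewrite /mxform linearZ/= -scalemxAr mxE. Qed.

Lemma mxform_delta T k l : mxform T (delta_mx 0 k) (delta_mx 0 l) = T k l.
Proof. by rewrite /mxform -rowE trmx_delta -colE !mxE. Qed.

Definition mxformE := (mxformDl, mxformDr, mxformZl, mxformZr, mxform_delta).

Section Rotation.
Variables (i j : 'I_n) (c s : R).

(** The rows of the rotation [rotmx] of cosine [c] and sine [s] in the plane of
    the coordinates [i] and [j]. *)
Definition rotrow (k : 'I_n) : 'rV[R]_n :=
  if k == i then c *: delta_mx 0 i + s *: delta_mx 0 j
  else if k == j then - s *: delta_mx 0 i + c *: delta_mx 0 j
  else delta_mx 0 k.

Definition rotmx : 'M[R]_n := \matrix_k rotrow k.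

Lemma rotmxE T k l :
  (rotmx *m T *m rotmx^T) k l = mxform T (rotrow k) (rotrow l).
Proof.
rewrite /mxform !mulmx_trE; apply: eq_bigr => a _; rewrite -(rowK rotrow k) -row_mul.
by rewrite !mxE.
Qed.

Lemma rotmx_ortho : i != j -> c ^+ 2 + s ^+ 2 = 1 -> rotmx *m rotmx^T = 1%:M.
Proof.
move=> ij cs; rewrite -[X in X *m _]mulmx1; apply/matrixP => k l; rewrite rotmxE.
have ji : j != i by rewrite eq_sym.
have {}cs : c ^+ 2 = 1 - s ^+ 2 by rewrite -cs addrK.
rewrite /rotrow; case: (eqVneq k i) => [->|ki]; last case: (eqVneq k j) => [->|kj];
  (case: (eqVneq l i) => [->|li]; last case: (eqVneq l j) => [->|lj]);
  rewrite !mxformE !mxE ?eqxx/= ?(negbTE ij) ?(negbTE ji) ?(eq_sym _ l) ?(negbTE ki)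
    ?(negbTE kj) ?(negbTE li) ?(negbTE lj) ?mulr0n ?mulr1n //; ring: cs.
Qed.

Lemma rotmx_diag_i T : T^T = T ->
  (rotmx *m T *m rotmx^T) i i = c ^+ 2 * T i i + 2 * c * s * T i j + s ^+ 2 * T j j.
Proof.
move=> /matrixP/(_ i j); rewrite mxE => Tij.
by rewrite rotmxE /rotrow eqxx !mxformE Tij; ring.
Qed.

Lemma rotmx_diag_j T : i != j -> T^T = T ->
  (rotmx *m T *m rotmx^T) j j = s ^+ 2 * T i i - 2 * c * s * T i j + c ^+ 2 * T j j.
Proof.
rewrite eq_sym => /negbTE ji /matrixP/(_ i j); rewrite mxE => Tij.
by rewrite rotmxE /rotrow ji eqxx !mxformE Tij; ring.
Qed.

Lemma rotmx_diag_other T k : k != i -> k != j ->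
  (rotmx *m T *m rotmx^T) k k = T k k.
Proof.
by move=> /negbTE ki /negbTE kj; rewrite rotmxE /rotrow ki kj mxform_delta.
Qed.

End Rotation.

(** A first-order stationarity condition: letting [x] tend to [0] from either
    side, the sign of the expression is that of [x * b]. *)
Lemma linear_coef_eq0 (a b : R) :
  (forall x, x * (x * a + (1 - x ^+ 2) * b) <= 0) -> b = 0.
Proof.
move=> h; apply/eqP/negPn/negP => b0.
have a0 := normr_ge0 a; have {}b0 : 0 < `|b| by rewrite normr_gt0.
(* Small enough for both [x ^ 2 <= 1 / 4] and [x * |a| <= |b| / 2]. *)
pose x := `|b| / (2 * (`|a| + `|b|)).
have x0 : 0 < x by rewrite divr_gt0// mulr_gt0// ltr_wpDl.
have xE : 2 * x * (`|a| + `|b|) = `|b| by rewrite /x; field; lra.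
have x1 : 2 * x <= 1 by rewrite /x mulrA ler_pdivrMr ?mul1r; lra.
clearbody x.
have hb y : `|y| = x -> y * (1 - x ^+ 2) * b <= x ^+ 2 * `|a|.
  move=> yx; have y2 : y ^+ 2 = x ^+ 2 by rewrite -yx real_normK ?num_real.
  have := h y; rewrite mulrDr mulrA -expr2 y2 mulrA; move: (y * _ * b) => t.
  have := ler_norm (- a); rewrite normrN; have := sqr_ge0 x; nra.
have {hb} : x * (1 - x ^+ 2) * `|b| <= x ^+ 2 * `|a|.
  have [b_ge0|b_lt0] := leP 0 b.
    by rewrite (ger0_norm b_ge0); apply: hb; rewrite gtr0_norm.
  have := hb (- x); rewrite normrN gtr0_norm// => /(_ erefl).
  by rewrite (ltr0_norm b_lt0) mulrN !mulNr.
rewrite expr2 -!mulrA ler_pM2l// => hx.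
have : x * x <= 4^-1 by nra.
have xb : 0 < x * `|b| by exact: mulr_gt0.
have : x * `|a| <= 2^-1 * `|b| by move: xE; rewrite mulrDr -!mulrA; lra.
nra.
Qed.

(** The orthogonal matrix [O] is chosen to maximise the weighted trace
    [\sum_k k * (O S O^T) k k].  Rotating the rows [i] and [j] of [O] cannot
    increase it and, the weights of [i] and [j] being distinct, the entry [(i, j)]
    of [O S O^T] vanishes. *)
Lemma symmetric_diagonalizable S : S^T = S ->
  exists2 O, O *m O^T = 1%:M & exists d : 'rV[R]_n, O *m S *m O^T = diag_mx d.
Proof.
move=> Ssym; pose F O := \sum_(k < n) k%:R * (O *m S *m O^T) k k.
have [u] : exists2 u, u \in orthoset &
    forall u', u' \in orthoset -> F (vec_mx u') <= F (vec_mx u).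
  apply: EVT_max_rV.
    by exists (mxvec 1%:M); rewrite /orthoset/= mxvecK mul1mx trmx1.
    exact: orthoset_compact.
  apply: continuous_subspaceT; apply: continuous_bigsum => k.
  apply: continuous_mul; first exact: cst_continuous.
  have -> : (fun u => (vec_mx u *m S *m (vec_mx u)^T) k k) =
      fun u => \sum_l (\sum_a vec_mx u k a * S a l) * vec_mx u k l.
    by apply/funext => u; rewrite mulmx_trE; apply: eq_bigr => l _; rewrite [in LHS]mxE.
  apply: continuous_bigsum => l; apply: continuous_mul; last exact: entry_continuous.
  apply: continuous_bigsum => a; apply: continuous_mul; last exact: cst_continuous.
  exact: entry_continuous.
rewrite inE /orthoset/=; set O := vec_mx u => OO Omax; exists O => //.
have {}Omax G : G *m G^T = 1%:M -> F (G *m O) <= F O.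
  move=> GG; rewrite -(mxvecK (G *m O)); apply: Omax; rewrite inE /= mxvecK.
  by rewrite trmx_mul mulmxA -(mulmxA G) OO mulmx1.
pose T := O *m S *m O^T.
have Tsym : T^T = T by rewrite /T !trmx_mul trmxK Ssym mulmxA.
exists (\row_i T i i); apply/matrixP => i j; rewrite -/T [RHS]mxE [X in _ = X *+ _]mxE.
have [->|ij] := eqVneq i j; first by rewrite mulr1n.
rewrite mulr0n.
have dij : (i%:R - j%:R : R) != 0 by rewrite subr_eq0 eqr_nat.
suff : (i%:R - j%:R) * T i j = 0 by move/eqP; rewrite mulf_eq0 (negbTE dij) => /eqP.
apply: (@linear_coef_eq0 ((i%:R - j%:R) * (T j j - T i i))) => x.
(* The rotation of tangent half-angle [x]. *)
have x1 : 0 < 1 + x ^+ 2 by rewrite ltr_pwDl// sqr_ge0.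
pose c := (1 - x ^+ 2) / (1 + x ^+ 2); pose s := 2 * x / (1 + x ^+ 2).
have cs : c ^+ 2 + s ^+ 2 = 1 by rewrite /c /s; field; rewrite lt0r_neq0.
have := Omax (rotmx i j c s) (rotmx_ortho ij cs).
have -> : F (rotmx i j c s *m O) =
    \sum_(k < n) k%:R * (rotmx i j c s *m T *m (rotmx i j c s)^T) k k.
  by apply: eq_bigr => k _; rewrite trmx_mul !mulmxA.
rewrite /F -/T; have ji : j != i by rewrite eq_sym.
rewrite (bigD1 i)//= (bigD1 j)//= [leRHS](bigD1 i)//= [X in _ <= _ + X](bigD1 j)//=.
rewrite [X in _ + (_ + X) <= _](eq_bigr (fun k : 'I_n => k%:R * T k k)); last first.
  by move=> k /andP[ki kj]; rewrite rotmx_diag_other.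
rewrite rotmx_diag_i// rotmx_diag_j// !addrA lerD2r.
rewrite -subr_le0.
have -> : i%:R * (c ^+ 2 * T i i + 2 * c * s * T i j + s ^+ 2 * T j j) +
    j%:R * (s ^+ 2 * T i i - 2 * c * s * T i j + c ^+ 2 * T j j) -
    (i%:R * T i i + j%:R * T j j) =
    4 / (1 + x ^+ 2) ^+ 2 * (x * (x * ((i%:R - j%:R) * (T j j - T i i)) +
      (1 - x ^+ 2) * ((i%:R - j%:R) * T i j))).
  by rewrite /c /s; field; rewrite lt0r_neq0.
by rewrite pmulr_rle0// divr_gt0// exprn_gt0.
Qed.

End SpectralTheorem.

(** * The matrix [1 + Z Z^T] *)

(** Up to an orthogonal change of the rows, the rows of [Z] are pairwise
    orthogonal; the numbers [e 0 i] are their squared norms. *)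
Lemma diagonalize_gram (R : realType) n m (Z : 'M[R]_(n, m)) :
  exists2 O : 'M[R]_n, O *m O^T = 1%:M &
  exists2 e : 'rV[R]_n, forall i, 0 <= e 0 i & (O *m Z) *m (O *m Z)^T = diag_mx e.
Proof.
have [|O OO [e Oe]] := @symmetric_diagonalizable R n (Z *m Z^T).
  by rewrite trmx_mul trmxK.
have OZ : (O *m Z) *m (O *m Z)^T = diag_mx e by rewrite -Oe trmx_mul !mulmxA.
exists O => //; exists e => // i.
move/matrixP/(_ i i): OZ; rewrite mulmx_trE [in RHS]mxE eqxx mulr1n => <-.
by rewrite sumr_ge0// => k _; rewrite -expr2 sqr_ge0.
Qed.

Section GramInverse.
Variables (R : realType) (n m : nat).
Implicit Types X Y Z : 'M[R]_(n, m).

(** An inverse square root of [1 + Z Z^T], up to transposition, of positive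
    determinant. *)
Lemma gram_inv_sqrt Z :
  exists2 C : 'M[R]_n, 0 < \det C & C *m (1%:M + Z *m Z^T) *m C^T = 1%:M.
Proof.
case: (diagonalize_gram Z) => O OO [e e0 OZ]; have OO' := mulmx1C OO.
pose E : 'M[R]_n := diag_mx (\row_i (Num.sqrt (1 + e 0 i))^-1).
have sq_gt0 i : 0 < Num.sqrt (1 + e 0 i) by rewrite sqrtr_gt0 ltr_pwDl.
exists (O^T *m E *m O).
  rewrite !det_mulmx det_tr mulrAC -expr2 mulr_gt0//.
    by rewrite exprn_even_gt0//= -unitfE -unitmxE; case: (mulmx1_unit OO).
  by rewrite det_diag prodr_gt0// => i _; rewrite mxE invr_gt0.
have -> : 1%:M + Z *m Z^T = O^T *m diag_mx (\row_i (1 + e 0 i)) *m O.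
  have -> : diag_mx (\row_i (1 + e 0 i)) = 1%:M + diag_mx e.
    by apply/matrixP => i j; rewrite !mxE -mulrnDl.
  rewrite -OZ mulmxDr mulmxDl mulmx1 OO' trmx_mul !mulmxA OO' mul1mx.
  by rewrite -(mulmxA _ O^T O) OO' mulmx1.
have Et : E^T = E by rewrite tr_diag_mx.
rewrite !trmx_mul trmxK Et -!mulmxA (mulmxA O O^T) OO mul1mx.
rewrite (mulmxA O O^T) OO mul1mx (mulmxA _ E O) (mulmxA E _ O).
have -> : E *m (diag_mx (\row_i (1 + e 0 i)) *m E) = 1%:M.
  rewrite /E !mulmx_diag; apply/matrixP => i j; rewrite !mxE; congr (_ *+ _).
  by rewrite mulrCA -invfM -expr2 sqr_sqrtr ?divff ?gt_eqF ?addr_ge0// ltr_pwDl.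
by rewrite mul1mx.
Qed.

Lemma gram_unit Z : 1%:M + Z *m Z^T \in unitmx.
Proof.
have [C _ CN] := gram_inv_sqrt Z.
by have [+ _] := mulmx1_unit CN; rewrite unitmx_mul => /andP[].
Qed.

Lemma gram_det_gt0 Z : 0 < \det (1%:M + Z *m Z^T).
Proof.
have [C C0 /(congr1 determinant)] := gram_inv_sqrt Z.
rewrite !det_mulmx det_tr det1 mulrAC -expr2 => h.
have : 0 < \det C ^+ 2 * \det (1%:M + Z *m Z^T) by rewrite h.
by rewrite pmulr_rgt0// exprn_gt0.
Qed.

(** [ginv Z] is the factor [(1 + Z Z^T)^-1] of the metric; the other factor
    [(1 + Z^T Z)^-1] is [ginv Z^T]. *)
Definition ginv k1 k2 (Z : 'M[R]_(k1, k2)) : 'M[R]_k1 := invmx (1%:M + Z *m Z^T).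

End GramInverse.

Section GramInverseTheory.
Variables (R : realType) (n m : nat).
Implicit Types X Y Z : 'M[R]_(n, m).

Lemma ginv_tr Z : (ginv Z)^T = ginv Z.
Proof. by rewrite /ginv trmx_inv linearD/= trmx1 trmx_mul trmxK. Qed.

Lemma mul_ginv Z : ginv Z *m (1%:M + Z *m Z^T) = 1%:M.
Proof. by rewrite mulVmx// gram_unit. Qed.

Lemma mulr_ginv Z : (1%:M + Z *m Z^T) *m ginv Z = 1%:M.
Proof. by rewrite mulmxV// gram_unit. Qed.

Lemma metricE Z X Y :
  metric Z X Y = \tr (ginv Z *m X *m ginv Z^T *m Y^T).
Proof. by rewrite /metric /ginv trmxK. Qed.

Lemma ginv_square Z : exists2 C : 'M[R]_n, C \in unitmx & ginv Z = C^T *m C.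
Proof.
have [C C0 CN] := gram_inv_sqrt Z.
have Cu : C \in unitmx by rewrite unitmxE unitfE gt_eqF.
exists C => //; have := mulmx1C CN; rewrite mulmxA => h.
by rewrite -[RHS]mulmx1 -(mulr_ginv Z) mulmxA h mul1mx.
Qed.

End GramInverseTheory.

Section Metric.
Variables (R : realType) (n m : nat).
Implicit Types X Y Z : 'M[R]_(n, m).

(** The two factors of the metric are intertwined by [Z]; these identities carry
    all the cancellations below. *)
Lemma mul_tr_ginv Z : Z^T *m ginv Z = ginv Z^T *m Z^T.
Proof.
have h : (1%:M + Z^T *m Z) *m Z^T = Z^T *m (1%:M + Z *m Z^T).
  by rewrite mulmxDl mulmxDr mul1mx mulmx1 mulmxA.
rewrite -[LHS]mul1mx -(mul_ginv Z^T) trmxK -mulmxA (mulmxA _ Z^T) h.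
by rewrite -(mulmxA Z^T) mulr_ginv mulmx1.
Qed.

Lemma mul_ginv_r Z : ginv Z *m Z = Z *m ginv Z^T.
Proof.
by apply: trmx_inj; rewrite !trmx_mul !ginv_tr mul_tr_ginv.
Qed.

Lemma ginv_conj Z : Z^T *m ginv Z *m Z = 1%:M - ginv Z^T.
Proof.
rewrite mul_tr_ginv -[in RHS](mul_ginv Z^T) trmxK mulmxDr mulmx1 mulmxA.
by rewrite [_ + _ - _]addrC addKr.
Qed.

Lemma metric_sym Z X Y : metric Z X Y = metric Z Y X.
Proof.
rewrite !metricE -mxtrace_tr !trmx_mul trmxK !ginv_tr mxtrace_mulC !mulmxA.
by rewrite -mulmxA mxtrace_mulC !mulmxA.
Qed.

Lemma metricDl Z X X' Y : metric Z (X + X') Y = metric Z X Y + metric Z X' Y.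
Proof. by rewrite /metric mulmxDr !mulmxDl mxtraceD. Qed.

Lemma metricZl Z a X Y : metric Z (a *: X) Y = a * metric Z X Y.
Proof. by rewrite /metric -scalemxAr -!scalemxAl mxtraceZ. Qed.

Lemma mxtrace_mul_tr_eq0 k1 k2 (M : 'M[R]_(k1, k2)) : \tr (M *m M^T) = 0 -> M = 0.
Proof.
move=> /eqP; rewrite psumr_eq0 => [/allP h|i _]; last first.
  by rewrite mulmx_trE sumr_ge0// => j _; rewrite -expr2 sqr_ge0.
apply/matrixP => i j; rewrite mxE.
have := h i (mem_index_enum _); rewrite /= mulmx_trE psumr_eq0 => [/allP h'|k _].
  by have := h' j (mem_index_enum _); rewrite /= mulf_eq0 orbb => /eqP.
by rewrite -expr2 sqr_ge0.
Qed.

Lemma metric_definite Z X : metric Z X X = 0 -> X = 0.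
Proof.
rewrite metricE; have [C Cu ->] := ginv_square Z.
have [C' C'u ->] := ginv_square Z^T.
have C'u' : C'^T \in unitmx by rewrite unitmx_tr.
have -> : \tr (C^T *m C *m X *m (C'^T *m C') *m X^T) =
    \tr ((C *m X *m C'^T) *m (C *m X *m C'^T)^T).
  by rewrite !trmx_mul trmxK -!mulmxA mxtrace_mulC !mulmxA.
move=> /mxtrace_mul_tr_eq0 CX0.
have : C *m X = 0.
  by rewrite -(mulmxK C'u' (C *m X)) CX0 mul0mx.
by move=> h; rewrite -(mulKmx Cu X) h mulmx0.
Qed.
End Metric.

(** * Entrywise differentiation of matrix-valued functions *)

Section MatrixDerivative.
Variables (R : realType) (V : normedModType R) (x v : V).

Lemma is_derive_bigsum (I : Type) (r : seq I) (P : pred I) (h : I -> V -> R)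
    (dh : I -> R) :
  (forall i, is_derive x v (h i) (dh i)) ->
  is_derive x v (fun y => \sum_(i <- r | P i) h i y) (\sum_(i <- r | P i) dh i).
Proof.
move=> hd; have -> : (fun y => \sum_(i <- r | P i) h i y) = \sum_(i <- r | P i) h i.
  by apply/funext => y; rewrite fct_sumE.
by elim/big_ind2 : _ => // [|? ? ? ? ? ?]; [exact: is_derive_cst|exact: is_deriveD].
Qed.

Lemma is_derive_mul (f g : V -> R) df dg :
  is_derive x v f df -> is_derive x v g dg ->
  is_derive x v (fun y => f y * g y) (df * g x + f x * dg).
Proof.
move=> fd gd; apply: is_derive_eq; rewrite addrC; congr (_ + _); exact: mulrC.
Qed.

Lemma is_derive_bigprod (I : eqType) (r : seq I) (f : I -> V -> R) (df : I -> R) :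
  uniq r -> (forall i, is_derive x v (f i) (df i)) ->
  is_derive x v (fun y => \prod_(i <- r) f i y)
    (\sum_(k <- r) \prod_(i <- r) if i == k then df i else f i x).
Proof.
move=> + fd; elim: r => [_|a r IH /= /andP[ar ur]].
  rewrite big_nil; have -> : (fun y => \prod_(i <- [::]) f i y) = cst 1.
    by apply/funext => y; rewrite big_nil.
  exact: is_derive_cst.
have -> : (fun y => \prod_(i <- a :: r) f i y) =
    fun y => f a y * \prod_(i <- r) f i y.
  by apply/funext => y; rewrite big_cons.
apply: (is_derive_eq (is_derive_mul (fd a) (IH ur))).
rewrite big_cons; congr (_ + _).
  rewrite big_cons eqxx; congr (_ * _); apply: eq_big_seq => i ir.
  by case: eqVneq ir ar => // -> ->.
rewrite mulr_sumr; apply: eq_big_seq => k kr; rewrite big_cons.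
by case: eqVneq kr ar => // -> ->.
Qed.

(** [dF] is the derivative of [F] at [x] along [v], taken entry by entry. *)
Definition mx_derive k1 k2 (F : V -> 'M[R]_(k1, k2)) (dF : 'M[R]_(k1, k2)) :=
  forall i j, is_derive x v (fun y => F y i j) (dF i j).

Lemma mx_derive_eq k1 k2 (F : V -> 'M[R]_(k1, k2)) dF dF' :
  mx_derive F dF -> dF = dF' -> mx_derive F dF'.
Proof. by move=> ? <-. Qed.

Lemma mx_derive_unique k1 k2 (F : V -> 'M[R]_(k1, k2)) dF dF' :
  mx_derive F dF -> mx_derive F dF' -> dF = dF'.
Proof.
move=> h h'; apply/matrixP => i j.
by rewrite -(@derive_val _ _ _ _ _ _ _ (h i j)) (@derive_val _ _ _ _ _ _ _ (h' i j)).
Qed.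

Lemma mx_derive_cst k1 k2 (A : 'M[R]_(k1, k2)) : mx_derive (fun=> A) 0.
Proof. by move=> i j; rewrite mxE; exact: is_derive_cst. Qed.

Lemma mx_deriveD k1 k2 (F G : V -> 'M[R]_(k1, k2)) dF dG :
  mx_derive F dF -> mx_derive G dG -> mx_derive (fun y => F y + G y) (dF + dG).
Proof.
move=> h h' i j; rewrite mxE.
have -> : (fun y => (F y + G y) i j) = (fun y => F y i j) + (fun y => G y i j).
  by apply/funext => y; rewrite mxE.
exact: is_deriveD.
Qed.

Lemma mx_derive_tr k1 k2 (F : V -> 'M[R]_(k1, k2)) dF :
  mx_derive F dF -> mx_derive (fun y => (F y)^T) dF^T.
Proof.
move=> h i j; rewrite mxE.
have -> // : (fun y => (F y)^T i j) = (fun y => F y j i).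
by apply/funext => y; rewrite mxE.
Qed.

Lemma mx_deriveM k1 k2 k3 (F : V -> 'M[R]_(k1, k2)) (G : V -> 'M[R]_(k2, k3)) dF dG :
  mx_derive F dF -> mx_derive G dG ->
  mx_derive (fun y => F y *m G y) (dF *m G x + F x *m dG).
Proof.
move=> h h' i j.
have -> : (fun y => (F y *m G y) i j) = (fun y => \sum_k F y i k * G y k j).
  by apply/funext => y; rewrite mxE.
apply: (is_derive_eq (is_derive_bigsum _ _ (fun k => is_derive_mul (h i k) (h' k j)))).
by rewrite !mxE -big_split.
Qed.

Lemma is_derive_mxtrace k (F : V -> 'M[R]_k) dF :
  mx_derive F dF -> is_derive x v (fun y => \tr (F y)) (\tr dF).
Proof. by move=> h; exact: is_derive_bigsum (fun i => h i i). Qed.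

(** Jacobi's formula for the derivative of a determinant. *)
Lemma is_derive_det k (F : V -> 'M[R]_k) dF :
  mx_derive F dF -> is_derive x v (fun y => \det (F y)) (\tr (dF *m \adj (F x))).
Proof.
move=> h; have hs (s : 'S_k) : is_derive x v
    (fun y => (-1) ^+ s * \prod_i F y i (s i))
    ((-1) ^+ s * \sum_a \prod_i if i == a then dF i (s i) else F x i (s i)).
  apply: is_derive_eq.
    apply: (is_derive_mul (is_derive_cst ((-1) ^+ s : R) x v)).
    apply: (@is_derive_bigprod _ _ (fun i y => F y i (s i)) (fun i => dF i (s i))) => //.
    exact: index_enum_uniq.
  by rewrite mul0r add0r.
apply: (is_derive_eq (is_derive_bigsum _ _ hs)).
under eq_bigr do rewrite mulr_sumr.
rewrite exchange_big; apply: eq_bigr => a _ /=.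
(* The sum over [s] is the determinant of [F x] with its row [a] replaced. *)
pose M : 'M[R]_k := \matrix_(i, j) if i == a then dF i j else F x i j.
transitivity (\det M).
  by apply: eq_bigr => s _; congr (_ * _); apply: eq_bigr => i _; rewrite mxE.
rewrite (expand_det_row M a) mxE; apply: eq_bigr => j _; rewrite !mxE eqxx.
congr (_ * (_ * \det _)); apply/matrixP => i l; rewrite !mxE eq_sym.
by rewrite (negbTE (neq_lift _ _)).
Qed.

Lemma mx_derive_derivable k1 k2 (F : V -> 'M[R]_(k1, k2)) :
  (forall i j, derivable (fun y => F y i j) x v) ->
  mx_derive F (\matrix_(i, j) 'D_v (fun y => F y i j) x).
Proof. by move=> h i j; rewrite mxE; exact: derivableP. Qed.

(** The cofactor formula gives the existence of the derivative of the inverse, and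
    differentiating [F^-1 F = 1] gives its value. *)
Lemma mx_derive_inv k (F : V -> 'M[R]_k) dF :
  (forall y, F y \in unitmx) -> mx_derive F dF ->
  mx_derive (fun y => invmx (F y)) (- (invmx (F x) *m dF *m invmx (F x))).
Proof.
move=> Fu h.
have /mx_derive_derivable hi : forall i j, derivable (fun y => invmx (F y) i j) x v.
  move=> i j.
  have -> : (fun y => invmx (F y) i j) =
      (fun y => (\det (F y))^-1) * (fun y => cofactor (F y) j i).
    by apply/funext => y; rewrite /invmx Fu !mxE.
  apply: derivableM.
    apply: derivableV; first by rewrite -unitfE -unitmxE.
    by have [] := is_derive_det h.
  rewrite /cofactor; apply: derivableM; first exact: derivable_cst.
  have h' : mx_derive (fun y => row' j (col' i (F y))) (row' j (col' i dF)).
    move=> a b; rewrite !mxE.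
    have -> : (fun y => row' j (col' i (F y)) a b) = fun y => F y (lift j a) (lift i b).
      by apply/funext => y; rewrite !mxE.
    exact: h.
  by have [] := is_derive_det h'.
apply: (mx_derive_eq hi); set dI := (X in X = _).
have := mx_deriveM hi h; rewrite -/dI.
have -> : (fun y => invmx (F y) *m F y) = fun=> 1%:M.
  by apply/funext => y; rewrite mulVmx.
move=> /mx_derive_unique/(_ (mx_derive_cst _)) /eqP; rewrite addr_eq0 => /eqP dIF.
by rewrite -[LHS](mulmxK (Fu x)) dIF mulNmx.
Qed.

(** A directional derivative is the derivative at [0] of the restriction to a
    line. *)
Lemma derive_line (f : V -> R) : 'D_v f x = 'D_1 (fun h : R => f (h *: v + x)) 0.
Proof.
rewrite /derive; set g1 := fun h => h^-1 *: _; set g2 := fun h => h^-1 *: _.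
suff -> : g1 = g2 by [].
by rewrite funeqE /g1 /g2 => h /=; rewrite addr0 scale0r add0r [_%:A]mulr1.
Qed.

Lemma is_derive_sqrt (f : V -> R) df :
  0 < f x -> is_derive x v f df ->
  is_derive x v (fun y => Num.sqrt (f y)) ((2 * Num.sqrt (f x))^-1 * df).
Proof.
move=> f0 [fd fE]; pose l (h : R) := f (h *: v + x).
have lx : l 0 = f x by rewrite /l scale0r add0r.
have ld : is_derive (0 : R) 1 l df.
  by split; [exact: (iffLR (derivable1P f x v) fd)|rewrite -derive_line].
have sd : is_derive (l 0) 1 Num.sqrt (2 * Num.sqrt (f x))^-1.
  by rewrite lx; exact: is_derive1_sqrt.
have [sld slE] := is_derive1_comp sd ld.
by split; [exact: (iffRL (derivable1P _ x v) sld)|rewrite derive_line].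
Qed.

End MatrixDerivative.

(** * The Hessian of the volume function *)

Section VolumeHessian.
Variables (R : realType) (n m : nat).
Implicit Types X Y W Z : 'M[R]_(n, m).

Lemma mx_derive_id Z X : mx_derive Z X (fun Y => Y) X.
Proof.
have did : derivable (fun Y : 'M[R]_(n, m) => Y) Z X by exact: derivable_id.
have /matrixP := derive_mx did; rewrite derive_id => h i j.
split; first by have /derivable_mxP := did; apply.
by rewrite h mxE.
Qed.

Lemma mx_derive_ginv Z X :
  mx_derive Z X (@ginv R n m)
    (- (ginv Z *m (X *m Z^T + Z *m X^T) *m ginv Z)).
Proof.
apply: mx_derive_inv => [Y|]; first exact: gram_unit.
apply: mx_derive_eq (mx_deriveD (mx_derive_cst _ _ _)
  (mx_deriveM (mx_derive_id Z X) (mx_derive_tr (mx_derive_id Z X)))) _.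
by rewrite add0r.
Qed.

Lemma mx_derive_ginv_tr Z X :
  mx_derive Z X (fun Y => ginv Y^T)
    (- (ginv Z^T *m (X^T *m Z + Z^T *m X) *m ginv Z^T)).
Proof.
rewrite /ginv; apply: mx_derive_inv => [Y|]; first exact: gram_unit.
have := mx_deriveD (mx_derive_cst Z X 1%:M) (mx_deriveM (mx_derive_tr (mx_derive_id Z X))
  (mx_derive_tr (mx_derive_tr (mx_derive_id Z X)))).
by rewrite add0r !trmxK.
Qed.

(** [vol Z] is the value of the function [v] at the plane of coordinate [Z], and
    [dlogvol Z X] the derivative of its logarithm in the direction [X]. *)
Definition vol Z : R := Num.sqrt (\det (1%:M + Z *m Z^T)).

Definition dlogvol Z X : R := \tr (ginv Z *m X *m Z^T).

Lemma vol_gt0 Z : 0 < vol Z.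
Proof. by rewrite sqrtr_gt0 gram_det_gt0. Qed.

Lemma sqr_vol Z : vol Z ^+ 2 = \det (1%:M + Z *m Z^T).
Proof. by rewrite sqr_sqrtr// ltW// gram_det_gt0. Qed.

Lemma is_derive_vol Z X : is_derive Z X vol (vol Z * dlogvol Z X).
Proof.
have N' : mx_derive Z X (fun Y => 1%:M + Y *m Y^T) (X *m Z^T + Z *m X^T).
  apply: mx_derive_eq (mx_deriveD (mx_derive_cst _ _ _)
    (mx_deriveM (mx_derive_id Z X) (mx_derive_tr (mx_derive_id Z X)))) _.
  by rewrite add0r.
have := is_derive_sqrt (f := fun Y => \det (1%:M + Y *m Y^T)) (gram_det_gt0 Z)
  (is_derive_det N').
set dv := (X in is_derive _ _ _ X); suff -> : dv = vol Z * dlogvol Z X by [].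
rewrite /dv; have -> : \adj (1%:M + Z *m Z^T) = vol Z ^+ 2 *: ginv Z.
  rewrite sqr_vol /ginv /invmx gram_unit scalerA divff ?scale1r//.
  by rewrite gt_eqF// gram_det_gt0.
rewrite -scalemxAr mxtraceZ mulmxDl mxtraceD.
have -> : \tr (X *m Z^T *m ginv Z) = dlogvol Z X by rewrite mxtrace_mulC mulmxA.
have -> : \tr (Z *m X^T *m ginv Z) = dlogvol Z X.
  by rewrite -mxtrace_tr !trmx_mul trmxK ginv_tr mulmxA.
rewrite -/(vol Z); field; by rewrite gt_eqF// vol_gt0.
Qed.

Lemma is_derive_dlogvol Z X Y :
  is_derive Z X (fun Z' => dlogvol Z' Y)
    (\tr (ginv Z *m Y *m X^T) -
     \tr (ginv Z *m (X *m Z^T + Z *m X^T) *m ginv Z *m Y *m Z^T)).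
Proof.
apply: is_derive_eq.
  apply: is_derive_mxtrace; apply: mx_deriveM.
    exact: (mx_deriveM (mx_derive_ginv Z X) (mx_derive_cst Z X Y)).
  exact: (mx_derive_tr (mx_derive_id Z X)).
by rewrite mulmx0 addr0 !mulNmx linearD linearN/= addrC.
Qed.

(** The derivative at [Z], in the direction [X], of [metric Z Y W]. *)
Definition dmetric Z X Y W : R :=
  - \tr (ginv Z *m (X *m Z^T + Z *m X^T) *m ginv Z *m Y *m ginv Z^T *m W^T)
  - \tr (ginv Z *m Y *m ginv Z^T *m (X^T *m Z + Z^T *m X) *m ginv Z^T *m W^T).

Lemma is_derive_metric Z X Y W :
  is_derive Z X (fun Z' => metric Z' Y W) (dmetric Z X Y W).
Proof.
have -> : (fun Z' => metric Z' Y W) =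
    fun Z' => \tr (ginv Z' *m Y *m ginv Z'^T *m W^T).
  by apply/funext => Z'; rewrite metricE.
apply: is_derive_eq.
  apply: is_derive_mxtrace; apply: mx_deriveM; last exact: mx_derive_cst.
  apply: mx_deriveM; last exact: mx_derive_ginv_tr.
  exact: (mx_deriveM (mx_derive_ginv Z X) (mx_derive_cst Z X Y)).
by rewrite !mulmx0 !addr0 mulmxDl linearD/= !mulNmx !mulmxN !mulNmx !linearN/= !mulmxA.
Qed.

(** The Christoffel symbols of the metric at [Z], assembled into a symmetric
    bilinear map with values in the tangent space. *)
Definition connection Z X Y : 'M[R]_(n, m) :=
  - (X *m ginv Z^T *m Z^T *m Y + Y *m ginv Z^T *m Z^T *m X).

Lemma metric_connection Z X Y W :
  metric Z (connection Z X Y) W =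
  - (\tr (ginv Z *m X *m ginv Z^T *m Z^T *m Y *m ginv Z^T *m W^T) +
     \tr (ginv Z *m Y *m ginv Z^T *m Z^T *m X *m ginv Z^T *m W^T)).
Proof.
by rewrite metricE /connection mulmxN mulmxDr !mulNmx !mulmxDl linearN linearD/= !mulmxA.
Qed.

(** Koszul's formula, which identifies [connection] as the Levi-Civita
    connection. *)
Lemma koszul Z X Y W :
  dmetric Z X Y W + dmetric Z Y X W - dmetric Z W X Y =
  2 * metric Z (connection Z X Y) W.
Proof.
pose a X Y W := \tr (ginv Z *m X *m ginv Z^T *m Z^T *m Y *m ginv Z^T *m W^T).
pose b X Y W := \tr (ginv Z *m Z *m X^T *m ginv Z *m Y *m ginv Z^T *m W^T).
pose c X Y W := \tr (ginv Z *m Y *m ginv Z^T *m X^T *m Z *m ginv Z^T *m W^T).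
have dE X' Y' W' : dmetric Z X' Y' W' =
    - (a X' Y' W' + b X' Y' W' + c X' Y' W' + a Y' X' W').
  rewrite /dmetric /a /b /c !mulmxDr !mulmxDl !linearD/= !mulmxA.
  rewrite -(mulmxA _ Z^T (ginv Z)) mul_tr_ginv !mulmxA.
  move: (\tr _) (\tr _) (\tr _) (\tr _) => t1 t2 t3 t4; ring.
have ac X' Y' W' : a W' X' Y' = c X' Y' W'.
  rewrite /a -mxtrace_tr !trmx_mul !trmxK !ginv_tr !mulmxA mxtrace_mulC.
  by rewrite !mulmxA.
have bc X' Y' W' : b W' X' Y' = c Y' X' W'.
  transitivity (\tr ((ginv Z *m Z *m W'^T) *m (ginv Z *m X' *m ginv Z^T *m Y'^T))).
    by rewrite !mulmxA.
  rewrite mxtrace_mulC !mulmxA -(mulmxA _ (ginv Z) Z) mul_ginv_r.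
  by rewrite !mulmxA.
have ba X' Y' W' : a X' W' Y' = b X' Y' W'.
  rewrite [RHS]/b -mxtrace_tr !trmx_mul !trmxK !ginv_tr.
  transitivity (\tr ((W' *m ginv Z^T *m Y'^T) *m (ginv Z *m X' *m (Z^T *m ginv Z)))).
    by rewrite mul_tr_ginv mxtrace_mulC /a !mulmxA.
  by rewrite !mulmxA.
rewrite !dE metric_connection -/(a X Y W) -/(a Y X W).
rewrite (ac X Y W) (bc X Y W) (ba X Y W) -(bc X W Y).
ring.
Qed.

Lemma coord_vect_sum X : X = \sum_k mxvec X 0 k *: coord_vect R k.
Proof.
rewrite -[LHS]mxvecK {1}(row_sum_delta (mxvec X)) linear_sum.
by apply: eq_bigr => k _; rewrite linearZ.
Qed.

(** A linear form is determined by its values on the coordinate vectors. *)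
Lemma coord_vect_linear (f : 'M[R]_(n, m) -> R) X :
  (forall X Y, f (X + Y) = f X + f Y) -> (forall a X, f (a *: X) = a * f X) ->
  \sum_k mxvec X 0 k * f (coord_vect R k) = f X.
Proof.
move=> fD fZ; rewrite [in RHS](coord_vect_sum X); symmetry.
elim/big_ind2: _ => [|Y a Y' b <- <-|i _]; [|exact: fD|exact: fZ].
by rewrite -(scale0r (0 : 'M[R]_(n, m))) fZ mul0r.
Qed.

Lemma mulmx_gram Z (c : 'rV[R]_(n * m)) l :
  (c *m gram Z) 0 l = metric Z (vec_mx c) (coord_vect R l).
Proof.
rewrite mxE -[RHS](@coord_vect_linear (fun X => metric Z X (coord_vect R l))).
- by apply: eq_bigr => k _; rewrite vec_mxK mxE.
- by move=> X Y; exact: metricDl.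
- by move=> a X; exact: metricZl.
Qed.

Lemma gram_matrix_unit Z : gram Z \in unitmx.
Proof.
rewrite -row_free_unit; apply: inj_row_free => c c0.
apply: (can_inj vec_mxK); rewrite linear0; apply: (@metric_definite _ _ _ Z).
rewrite -[LHS](@coord_vect_linear (fun X => metric Z X (vec_mx c))).
- rewrite big1// => k _; rewrite metric_sym -mulmx_gram c0 mxE mulr0//.
- by move=> X Y; exact: metricDl.
- by move=> a X; exact: metricZl.
Qed.

Lemma christoffelE Z (k i j : 'I_(n * m)) :
  christoffel k i j Z = mxvec (connection Z (coord_vect R i) (coord_vect R j)) 0 k.
Proof.
set c := mxvec _; have pE a b e : partial a (fun Z' => gram Z' b e) Z =
    dmetric Z (coord_vect R a) (coord_vect R b) (coord_vect R e).
  have -> : (fun Z' => gram Z' b e) =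
      fun Z' => metric Z' (coord_vect R b) (coord_vect R e).
    by apply/funext => Z'; rewrite mxE.
  rewrite /partial.
  by have [_ ->] := is_derive_metric Z (coord_vect R a) (coord_vect R b) (coord_vect R e).
have sym : (invmx (gram Z))^T = invmx (gram Z).
  by rewrite trmx_inv; congr invmx; apply/matrixP => a b; rewrite !mxE metric_sym.
rewrite -[c]mulmx1 -(mulmxV (gram_matrix_unit Z)) mulmxA mxE /christoffel mulr_sumr.
apply: eq_bigr => l _; rewrite !pE koszul mulmx_gram mxvecK -{2}sym mxE.
move: (metric _ _ _) (invmx _ _ _) => x y; by field.
Qed.

(** In [hess_coord], the second derivative of [vol] and its connection term
    combine: the traces that contain [Z X^T] turn the trace of [ginv Z Y X^T] into
    the metric. *)
Lemma hess_volE Z X Y :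
  hess_coord vol Z X Y =
  vol Z * (dlogvol Z X * dlogvol Z Y + metric Z X Y +
           \tr (ginv Z *m X *m Z^T *m ginv Z *m Y *m Z^T)).
Proof.
pose f X Y := vol Z * (dlogvol Z X * dlogvol Z Y + metric Z X Y +
           \tr (ginv Z *m X *m Z^T *m ginv Z *m Y *m Z^T)).
have dlD X' Y' : dlogvol Z (X' + Y') = dlogvol Z X' + dlogvol Z Y'.
  by rewrite /dlogvol mulmxDr mulmxDl mxtraceD.
have dlZ a X' : dlogvol Z (a *: X') = a * dlogvol Z X'.
  by rewrite /dlogvol -scalemxAr -scalemxAl mxtraceZ.
have fDl X1 X2 Y' : f (X1 + X2) Y' = f X1 Y' + f X2 Y'.
  rewrite /f dlD metricDl !mulmxDr !mulmxDl linearD/=; ring.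
have fZl a X' Y' : f (a *: X') Y' = a * f X' Y'.
  rewrite /f dlZ metricZl -!scalemxAr -!scalemxAl linearZ/=; ring.
have f_sym X' Y' : f X' Y' = f Y' X'.
  rewrite /f metric_sym [dlogvol Z X' * _]mulrC; congr (_ * (_ + _)).
  transitivity (\tr ((ginv Z *m X' *m Z^T) *m (ginv Z *m Y' *m Z^T))).
    by rewrite !mulmxA.
  by rewrite mxtrace_mulC !mulmxA.
rewrite -[RHS]/(f X Y) -(@coord_vect_linear (f^~ Y)) => [|//|//].
apply: eq_bigr => i _; rewrite f_sym -(@coord_vect_linear (f^~ _)) => [|//|//].
rewrite mulr_sumr; apply: eq_bigr => j _; rewrite mulrA f_sym; congr (_ * _).
set Ei := coord_vect R i; set Ej := coord_vect R j.
have pvol k : partial k vol = fun Z' => vol Z' * dlogvol Z' (coord_vect R k).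
  by apply/funext => Z'; have [_ <-] := is_derive_vol Z' (coord_vect R k).
have -> : \sum_k christoffel k i j Z * partial k vol Z =
    vol Z * dlogvol Z (connection Z Ei Ej).
  rewrite -[dlogvol Z _](@coord_vect_linear (dlogvol Z)) => [|//|//].
  rewrite mulr_sumr; apply: eq_bigr => k _; rewrite christoffelE pvol mulrCA//.
have -> : partial i (partial j vol) Z =
    vol Z * dlogvol Z Ei * dlogvol Z Ej + vol Z *
    (\tr (ginv Z *m Ej *m Ei^T) -
     \tr (ginv Z *m (Ei *m Z^T + Z *m Ei^T) *m ginv Z *m Ej *m Z^T)).
  rewrite pvol /partial.
  by have [_] := is_derive_mul (is_derive_vol Z Ei) (is_derive_dlogvol Z Ei Ej).
rewrite /f.
have -> : metric Z Ei Ej = \tr (ginv Z *m Ej *m Ei^T) -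
    \tr (ginv Z *m Z *m Ei^T *m ginv Z *m Ej *m Z^T).
  rewrite metric_sym metricE -[ginv Z^T](subKr 1%:M) -ginv_conj.
  rewrite mulmxBr mulmx1 mulmxBl linearB/=; congr (_ - _).
  transitivity (\tr ((ginv Z *m Ej *m Z^T) *m (ginv Z *m Z *m Ei^T))).
    by rewrite !mulmxA.
  by rewrite mxtrace_mulC !mulmxA.
have -> : dlogvol Z (connection Z Ei Ej) =
    - (\tr (ginv Z *m Ei *m Z^T *m ginv Z *m Ej *m Z^T) +
       \tr (ginv Z *m Ej *m Z^T *m ginv Z *m Ei *m Z^T)).
  rewrite /dlogvol /connection -!(mulmxA _ (ginv Z^T) Z^T) -mul_tr_ginv.
  by rewrite mulmxN mulNmx mulmxDr mulmxDl linearN linearD/= !mulmxA.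
have -> : \tr (ginv Z *m Ej *m Z^T *m ginv Z *m Ei *m Z^T) =
    \tr (ginv Z *m Ei *m Z^T *m ginv Z *m Ej *m Z^T).
  transitivity (\tr ((ginv Z *m Ej *m Z^T) *m (ginv Z *m Ei *m Z^T))).
    by rewrite !mulmxA.
  by rewrite mxtrace_mulC !mulmxA.
rewrite mulmxDr !mulmxDl linearD/= !mulmxA.
ring.
Qed.

End VolumeHessian.

(** * The function in the graph coordinate *)

Section GraphCoordinate.
Variables (R : realType) (n m : nat) (eps : onbasis R (n + m)).
Implicit Types (P : grassmannian R n m) (Z : 'M[R]_(n, m)).

Lemma onmxC : (eps : 'M[R]_(n + m))^T *m eps = 1%:M.
Proof. exact: mulmx1C (onmxP eps). Qed.

Lemma mul_eps_usub (M : 'M[R]_(n, n + m)) :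
  M *m eps *m (usubmx (eps : 'M[R]_(n + m)))^T = lsubmx M.
Proof. by rewrite trmx_usub mulmx_lsub -mulmxA onmxP mulmx1. Qed.

Lemma graph_basis_gram Z :
  graph_basis eps Z *m (graph_basis eps Z)^T = 1%:M + Z *m Z^T.
Proof.
rewrite /graph_basis trmx_mul mulmxA -(mulmxA _ _ (eps : 'M[R]_(n + m))^T) onmxP mulmx1.
by rewrite tr_row_mx mul_row_col trmx1 mulmx1.
Qed.

Lemma oriented_bases_mul P e (C : 'M[R]_n) : bases P e -> 0 < \det C -> bases P (C *m e).
Proof.
case: P => bs [E rE bsE] /=; rewrite {}bsE => -[A [A0 ->]] C0.
by exists (C *m A); rewrite det_mulmx mulr_gt0 ?mulmxA.
Qed.

Lemma oriented_bases_change P e e' : bases P e -> bases P e' ->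
  exists2 C : 'M[R]_n, 0 < \det C & e' = C *m e.
Proof.
case: P => bs [E rE bsE] /=; rewrite {}bsE => -[A [A0 ->]] [A' [A'0 ->]].
have Au : A \in unitmx by rewrite unitmxE unitfE gt_eqF.
exists (A' *m invmx A); first by rewrite det_mulmx det_inv mulr_gt0 ?invr_gt0.
by rewrite -mulmxA (mulKmx Au).
Qed.

(** If [e = C * graph_basis Z] is orthonormal, the matrix of the scalar products
    with the first [n] vectors of [eps] is [C], and [C (1 + Z Z^T) C^T = 1]. *)
Lemma w_graph P Z : bases P (graph_basis eps Z) -> w eps P = (vol Z)^-1.
Proof.
move=> PZ; have [C C0 CN] := gram_inv_sqrt Z.
have onbP e C' : e = C' *m graph_basis eps Z ->
    e *m e^T = C' *m (1%:M + Z *m Z^T) *m C'^T.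
  by move=> ->; rewrite trmx_mul mulmxA -(mulmxA C') graph_basis_gram.
have : oriented_onb P (C *m graph_basis eps Z).
  by split; [exact: oriented_bases_mul|rewrite (onbP _ _ C erefl)].
rewrite /w => /(xgetI 0); set e := xget _ _ => -[Pe ee].
have [C' C'0 eE] := oriented_bases_change PZ Pe.
rewrite eE /graph_basis mulmxA mul_eps_usub -mulmx_lsub row_mxKl mulmx1.
have := congr1 determinant (onbP _ _ _ eE); rewrite ee det1 !det_mulmx det_tr.
rewrite -sqr_vol mulrAC -expr2 -exprMn => /eqP; rewrite eq_sym sqrf_eq1.
have := vol_gt0 Z => vZ.
have C'v : 0 < \det C' * vol Z by rewrite mulr_gt0.
case/orP => /eqP h; last by rewrite h oppr_gt0 ltr10 in C'v.
by rewrite -[LHS](mulfK (lt0r_neq0 vZ)) h mul1r.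
Qed.

Lemma v_plane : v eps \o plane eps = @vol R n m.
Proof.
apply/funext => Z /=; rewrite /v (@w_graph _ Z) ?invrK//.
by exists 1%:M; rewrite det1 mul1mx; split.
Qed.

(** A plane of [U] has a coordinate: if [C] and [D] are the blocks of the
    components of an orthonormal basis, then [C] is invertible and the coordinate
    is [C^-1 D]. *)
Lemma U_coord P : (0 < n)%N -> U eps P -> bases P (graph_basis eps (Defs.coord eps P)).
Proof.
move=> n0; rewrite /U/= /w; set e := xget _ _ => w0.
have [Pe ee] : oriented_onb P e.
  have [onbP|onbP] := pselect (exists e', oriented_onb P e'); first exact: xgetPex.
  (* Otherwise [e] would be the default value [0], and the determinant zero. *)
  have e0 : e = 0 by apply: xgetPN => e' Pe'; apply: onbP; exists e'.
  move: w0; rewrite e0 mul0mx -(scale0r (0 : 'M[R]_n)) detZ expr0n.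
  by rewrite eqn0Ngt n0 mul0r ltxx.
set C := e *m _ in w0; have Cu : C \in unitmx by rewrite unitmxE unitfE gt_eqF.
apply: (@xgetPex _ 0 [set Z | bases P (graph_basis eps Z)]%classic).
exists (invmx C *m rsubmx (e *m (eps : 'M[R]_(n + m))^T)) => /=.
suff -> : graph_basis eps (invmx C *m rsubmx (e *m (eps : 'M[R]_(n + m))^T)) =
    invmx C *m e.
  by apply: oriented_bases_mul => //; rewrite det_inv invr_gt0.
have CE : C = lsubmx (e *m (eps : 'M[R]_(n + m))^T).
  by rewrite /C trmx_usub mulmx_lsub.
rewrite /graph_basis -(mulVmx Cu) -mul_mx_row {2}CE hsubmxK -!mulmxA onmxC.
by rewrite mulmx1.
Qed.

Lemma v_coord P : (0 < n)%N -> U eps P -> v eps P = vol (Defs.coord eps P).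
Proof. by move=> n0 UP; rewrite /v (w_graph (U_coord n0 UP)) invrK. Qed.

End GraphCoordinate.

(** * Diagonal form of the Hessian *)

Section DiagonalForm.
Variables (R : realType) (n m : nat).
Implicit Types X Z : 'M[R]_(n, m).

Lemma char_poly_ortho (O S : 'M[R]_n) : O *m O^T = 1%:M ->
  char_poly (O *m S *m O^T) = char_poly S.
Proof.
move=> OO; rewrite /char_poly; pose f := map_mx (m := n) (n := n) (@polyC R).
have fO : f O *m f O^T = 1%:M by rewrite /f -map_mxM OO map_mx1.
have -> : char_poly_mx (O *m S *m O^T) = f O *m char_poly_mx S *m f O^T.
  rewrite /char_poly_mx mulmxBr mulmxBl /f !map_mxM/=; congr (_ - _).
  by rewrite scalar_mxC -mulmxA fO mulmx1.
by rewrite !det_mulmx mulrAC -det_mulmx fO det1 mul1r.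
Qed.

(** Nonzero pairwise orthogonal rows are at most as many as the columns. *)
Lemma card_diag_gram Z (e : 'rV[R]_n) : Z *m Z^T = diag_mx e ->
  (#|[pred i | e 0%R i != 0%R]| <= minn n m)%N.
Proof.
move=> ZZ; set K := [pred i | _]; rewrite leq_min.
have -> /= : (#|K| <= n)%N by rewrite -[leqRHS](card_ord n) max_card.
pose f (a : 'I_#|K|) : 'I_n := enum_val a.
have rk : rowsub f Z *m (rowsub f Z)^T \in unitmx.
  have -> : rowsub f Z *m (rowsub f Z)^T = diag_mx (\row_a e 0 (f a)).
    apply/matrixP => a b; rewrite mulmx_trE !mxE.
    have := congr1 (fun M : 'M[R]_n => M (f a) (f b)) ZZ; rewrite /= mulmx_trE mxE.
    rewrite (inj_eq enum_val_inj) => <-.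
    by apply: eq_bigr => k _; rewrite !mxE.
  rewrite unitmxE unitfE det_diag; apply/prodf_neq0 => a _; rewrite mxE.
  by have := enum_valP a; rewrite inE.
rewrite -(mxrank_unit rk) (leq_trans (mxrankM_maxl _ _))//; exact: rank_leq_col.
Qed.

(** In an orthonormal basis of eigenvectors of [Z Z^T], of eigenvalues [e i],
    the quadratic forms of the Hessian are expressed by the entries of a square
    matrix [r]; the bound on the metric is Bessel's inequality, and the
    convention [x / 0 = 0] drops the terms of the zero eigenvalues. *)
Lemma diagonal_form Z X : exists (e : 'I_n -> R) (r : 'M[R]_n),
  [/\ forall i, 0 <= e i,
      char_poly (Z *m Z^T) = \prod_i ('X - (e i)%:P),
      vol Z ^+ 2 = \prod_i (1 + e i) &
      (#|[pred i | e i != 0%R]| <= minn n m)%N] /\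
  [/\ forall i j, e j = 0 -> r i j = 0,
      dlogvol Z X = \sum_i r i i,
      \tr (ginv Z *m X *m Z^T *m ginv Z *m X *m Z^T) = \sum_i \sum_j r i j * r j i &
      \sum_i \sum_j r i j ^+ 2 / e j <= metric Z X X].
Proof.
case: (diagonalize_gram Z) => O OO [e e0 OZ]; have OO' := mulmx1C OO.
pose a i : R := (1 + e 0 i)^-1.
have a0 i : 0 < a i by rewrite invr_gt0 ltr_pwDl.
have [q qE] : exists q, q = (O *m X) *m (O *m Z)^T by eexists.
exists (e 0); exists (\matrix_(i, j) (Num.sqrt (a i * a j) * q i j)).
have De : O *m (Z *m Z^T) *m O^T = diag_mx e by rewrite -OZ trmx_mul !mulmxA.
pose D1 : 'M[R]_n := diag_mx (\row_i (1 + e 0 i)).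
pose Da : 'M[R]_n := diag_mx (\row_i a i).
have ON : O *m (1%:M + Z *m Z^T) = D1 *m O.
  have -> : D1 = 1%:M + diag_mx e by apply/matrixP => i j; rewrite !mxE -mulrnDl.
  by rewrite -De mulmxDl mulmxDr mul1mx mulmx1 -(mulmxA _ O^T O) OO' mulmx1.
have DaD1 : Da *m D1 = 1%:M.
  rewrite mulmx_diag; apply/matrixP => i j; rewrite !mxE mulVf// gt_eqF//.
  by rewrite ltr_pwDl.
have OA : O *m ginv Z = Da *m O.
  by rewrite -[LHS]mul1mx -DaD1 -mulmxA (mulmxA D1) -ON -(mulmxA O) mulr_ginv mulmx1.
have XZ : X *m Z^T = O^T *m q *m O.
  rewrite qE trmx_mul !mulmxA OO' mul1mx -!mulmxA OO' mulmx1//.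
have AE : ginv Z = O^T *m Da *m O by rewrite -mulmxA -OA mulmxA OO' mul1mx.
have AXZ : ginv Z *m X *m Z^T = O^T *m (Da *m q) *m O.
  rewrite -(mulmxA (ginv Z)) XZ AE -!mulmxA; congr (_ *m (_ *m _)).
  by rewrite !mulmxA OO mul1mx.
have trO (M : 'M[R]_n) : \tr (O^T *m M *m O) = \tr M.
  by rewrite mxtrace_mulC mulmxA OO mul1mx.
have q0 i j : e 0 j = 0 -> q i j = 0.
  move=> ej; have := congr1 (fun M : 'M[R]_n => M j j) OZ.
  rewrite /= mulmx_trE mxE ej mul0rn => /eqP.
  rewrite psumr_eq0 => [/allP Oj|k _]; last first.
    by rewrite -expr2 sqr_ge0.
  rewrite qE mulmx_trE big1// => k _.
  have := Oj k (mem_index_enum _); rewrite /= mulf_eq0 orbb => /eqP ->.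
  by rewrite mulr0.
have sq_a i j : Num.sqrt (a i * a j) ^+ 2 = a i * a j.
  by rewrite sqr_sqrtr// mulr_ge0// ltW.
split; split.
- exact: e0.
- rewrite -(char_poly_ortho _ OO) De char_poly_trig ?diag_mx_is_trig//.
  by apply: eq_bigr => i _; rewrite mxE eqxx.
- have detO : \det O != 0 by rewrite -unitfE -unitmxE; case: (mulmx1_unit OO).
  have := congr1 determinant ON; rewrite !det_mulmx mulrC -sqr_vol => /(mulIf detO) ->.
  by rewrite det_diag; apply: eq_bigr => i _; rewrite mxE.
- exact: card_diag_gram OZ.
- by move=> i j ej; rewrite mxE q0 ?mulr0.
- rewrite /dlogvol AXZ trO; apply: eq_bigr => i _; rewrite mul_diag_mx !mxE.
  by rewrite -expr2 sqrtr_sqr gtr0_norm.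
- have -> : ginv Z *m X *m Z^T *m ginv Z *m X *m Z^T =
      O^T *m (Da *m q *m (Da *m q)) *m O.
    transitivity ((ginv Z *m X *m Z^T) *m (ginv Z *m X *m Z^T)); first by rewrite !mulmxA.
    rewrite AXZ.
    rewrite -!mulmxA; congr (_ *m (_ *m (_ *m _))); by rewrite !mulmxA OO mul1mx.
  rewrite trO; apply: eq_bigr => i _; rewrite mxE; apply: eq_bigr => j _.
  rewrite !mul_diag_mx !mxE (mulrC (a j) (a i)) [RHS]mulrACA -expr2 sq_a; ring.
pose G := (O *m X) *m (O *m X)^T.
have gE : metric Z X X = \sum_i a i * (G i i - \sum_j a j * q i j ^+ 2).
  rewrite metricE -[ginv Z^T](subKr 1%:M) -ginv_conj.
  rewrite mulmxBr mulmx1 mulmxBl linearB/=.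
  have -> : ginv Z *m X *m X^T = O^T *m (Da *m G) *m O.
    rewrite AE /G trmx_mul -!mulmxA; congr (_ *m (_ *m (_ *m _))).
    by rewrite OO' mulmx1.
  have -> : ginv Z *m X *m (Z^T *m ginv Z *m Z) *m X^T =
      O^T *m (Da *m q *m (Da *m q^T)) *m O.
    have ZX : Z *m X^T = O^T *m q^T *m O.
      by rewrite -[LHS]trmxK trmx_mul trmxK XZ !trmx_mul trmxK mulmxA.
    rewrite !mulmxA AXZ -(mulmxA _ Z X^T) ZX AE.
    rewrite -!mulmxA; congr (_ *m (_ *m (_ *m _))).
    by rewrite (mulmxA O O^T) OO mul1mx (mulmxA O O^T) OO mul1mx.
  rewrite !trO -sumrB; apply: eq_bigr => i _.
  rewrite mul_diag_mx !mxE mulrBr; congr (_ - _).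
  rewrite mulr_sumr; apply: eq_bigr => j _; rewrite !mul_diag_mx !mxE; ring.
(* [Y] is the remainder of the orthogonal projection of the rows of [O *m X] on
   the span of the rows of [O *m Z]. *)
have bessel i : \sum_j q i j ^+ 2 / e 0 j <= G i i.
  pose Di : 'M[R]_n := diag_mx (\row_j (e 0 j)^-1).
  pose Y := O *m X - q *m Di *m (O *m Z).
  have : 0 <= (Y *m Y^T) i i.
    by rewrite mulmx_trE sumr_ge0// => k _; rewrite -expr2 sqr_ge0.
  have -> : Y *m Y^T = G - q *m Di *m q^T.
    have qT : (O *m Z) *m (O *m X)^T = q^T by rewrite qE [RHS]trmx_mul trmxK.
    have DiT : Di^T = Di by rewrite tr_diag_mx.
    have DDD : Di *m diag_mx e *m Di = Di.
      rewrite !mulmx_diag; apply/matrixP => k l; rewrite !mxE; congr (_ *+ _).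
      by have [->|?] := eqVneq (e 0 k) 0; rewrite ?invr0 ?mulr0// mulVf// mul1r.
    rewrite /Y linearB/= mulmxBl !mulmxBr -/G (trmx_mul (q *m Di)) (trmx_mul q) DiT.
    rewrite (mulmxA (O *m X)) -qE (mulmxA q) -(mulmxA (q *m Di)) qT.
    rewrite -(mulmxA (q *m Di)) (mulmxA (O *m Z)) OZ.
    have -> : q *m Di *m (diag_mx e *m (Di *m q^T)) = q *m Di *m q^T.
      by rewrite -!mulmxA; congr (_ *m _); rewrite !mulmxA DDD.
    by rewrite subrr subr0.
  rewrite mxE [X in _ + X]mxE subr_ge0; apply: le_trans.
  rewrite mulmx_trE le_eqVlt; apply/orP; left; apply/eqP; apply: eq_bigr => j _.
  rewrite mul_mx_diag !mxE; ring.
rewrite gE; apply: ler_sum => i _.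
apply: (@le_trans _ _ (a i * (\sum_j q i j ^+ 2 / e 0 j - \sum_j a j * q i j ^+ 2))).
  rewrite -sumrB mulr_sumr; apply: ler_sum => j _; rewrite mxE exprMn sq_a.
  have [ej|ej] := eqVneq (e 0 j) 0; first by rewrite q0// expr0n !mulr0 mul0r subr0 mulr0.
  rewrite le_eqVlt; apply/orP; left; apply/eqP.
  have -> : a j = (1 + e 0 j)^-1 by []; move: (a i) => ai; field.
  by rewrite ej gt_eqF// ltr_pwDl.
by rewrite ler_pM2l// lerB.
Qed.

End DiagonalForm.

(** * Scalar inequalities *)

Section ScalarInequalities.
Variables (R : realType) (n : nat).
Implicit Types (e : 'I_n -> R) (r : 'M[R]_n) (c : R).

(** The contribution of a pair of symmetric off-diagonal entries: with
    [s = x / sqrt e] and [t = y / sqrt d] it is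
    [c * (s ^ 2 + t ^ 2) + 2 * sqrt (d * e) * s * t]. *)
Lemma pair_form_ge0 (c d e x y : R) : 0 <= c -> 0 <= d -> 0 <= e -> d * e <= c ^+ 2 ->
  (e = 0 -> x = 0) -> (d = 0 -> y = 0) ->
  0 <= (c * (x ^+ 2 / e) + x * y) + (c * (y ^+ 2 / d) + y * x).
Proof.
move=> c0 d0 e0 dec x0 y0.
have [ez|ez] := eqVneq e 0.
  rewrite (x0 ez); have -> : (c * (0 ^+ 2 / e) + 0 * y) + (c * (y ^+ 2 / d) + y * 0) =
    c * (y ^+ 2 / d) by ring.
  by rewrite mulr_ge0// divr_ge0// sqr_ge0.
have [dz|dz] := eqVneq d 0.
  rewrite (y0 dz); have -> : (c * (x ^+ 2 / e) + x * 0) + (c * (0 ^+ 2 / d) + 0 * x) =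
    c * (x ^+ 2 / e) by ring.
  by rewrite mulr_ge0// divr_ge0// sqr_ge0.
pose al := Num.sqrt d; pose be := Num.sqrt e.
have dE : d = al ^+ 2 by rewrite sqr_sqrtr.
have eE : e = be ^+ 2 by rewrite sqr_sqrtr.
have al0 : 0 < al by rewrite sqrtr_gt0 lt0r dz.
have be0 : 0 < be by rewrite sqrtr_gt0 lt0r ez.
have abc : al * be <= c.
  have ab0 : 0 <= al * be by rewrite mulr_ge0 ?sqrtr_ge0.
  by rewrite -(@ler_pXn2r _ 2) ?nnegrE// exprMn -dE -eE.
have -> : (c * (x ^+ 2 / e) + x * y) + (c * (y ^+ 2 / d) + y * x) =
    (c - al * be) * ((x / be) ^+ 2 + (y / al) ^+ 2) + al * be * (x / be + y / al) ^+ 2.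
  by rewrite dE eE; field; rewrite !gt_eqF.
apply: addr_ge0; apply: mulr_ge0.
- by rewrite subr_ge0.
- by apply: addr_ge0; exact: sqr_ge0.
- by rewrite ltW// mulr_gt0.
- exact: sqr_ge0.
Qed.

(** Only the diagonal of [r] matters in the lower bound for the Hessian. *)
Lemma diag_le_form c e r : 0 <= c -> (forall i, 0 <= e i) ->
  (forall i j, i != j -> e i * e j <= c ^+ 2) ->
  (forall i j, e j = 0 -> r i j = 0) ->
  \sum_i (c / e i + 1) * r i i ^+ 2 <=
  c * (\sum_i \sum_j r i j ^+ 2 / e j) + \sum_i \sum_j r i j * r j i.
Proof.
move=> c0 e0 ec r0; pose h i j := c * (r i j ^+ 2 / e j) + r i j * r j i.
have -> : c * (\sum_i \sum_j r i j ^+ 2 / e j) + \sum_i \sum_j r i j * r j i =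
    \sum_i \sum_j h i j.
  rewrite mulr_sumr -big_split; apply: eq_bigr => i _ /=.
  by rewrite mulr_sumr -big_split.
have -> : \sum_i \sum_j h i j = 2^-1 * \sum_i \sum_j (h i j + h j i).
  under [in RHS]eq_bigr do rewrite big_split/=.
  by rewrite big_split/= [X in _ + X]exchange_big/=; field.
rewrite mulr_sumr; apply: ler_sum => i _.
rewrite (bigD1 i)//= mulrDr -[leLHS]addr0 lerD//.
  have -> : (c / e i + 1) * r i i ^+ 2 = h i i by rewrite /h; ring.
  by move: (h i i) => z; lra.
apply: mulr_ge0; rewrite ?invr_ge0//; apply: sumr_ge0 => j ji; apply: pair_form_ge0 => //.
- by apply: ec; rewrite eq_sym.

- exact: r0.
- exact: r0.
Qed.

(** The Cauchy-Schwarz inequality with the weights [c / e i + 1], whose inverses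
    are [e i / (c + e i)]. *)
Lemma weighted_cauchy c k e (y : 'I_n -> R) : 0 < c -> 0 < k -> (forall i, 0 <= e i) ->
  (forall i, e i = 0 -> y i = 0) -> k * (\sum_i e i / (c + e i)) <= 1 ->
  k * (\sum_i y i) ^+ 2 <= \sum_i (c / e i + 1) * y i ^+ 2.
Proof.
move=> c0 k0 e0 y0; set S := \sum_i e i / _; set t := \sum_i y i => kS.
have : 0 <= \sum_i (c / e i + 1) * (y i - t * k * (e i / (c + e i))) ^+ 2.
  apply: sumr_ge0 => i _; rewrite mulr_ge0 ?sqr_ge0// addr_ge0// divr_ge0//.
  exact: ltW.
have -> : \sum_i (c / e i + 1) * (y i - t * k * (e i / (c + e i))) ^+ 2 =
    \sum_i (c / e i + 1) * y i ^+ 2 - 2 * t * k * t + (t * k) ^+ 2 * S.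
  transitivity (\sum_i ((c / e i + 1) * y i ^+ 2 - 2 * t * k * y i +
      (t * k) ^+ 2 * (e i / (c + e i)))); last first.
    by rewrite big_split/= sumrB -!mulr_sumr.
  apply: eq_bigr => i _ /=.
  have [ei|ei] := eqVneq (e i) 0; first by rewrite (y0 i ei) ei; ring.
  by field; rewrite ei gt_eqF// ltr_wpDr.
have := sqr_ge0 t; have -> : (t * k) ^+ 2 * S = k * t ^+ 2 * (k * S) by ring.
have -> : 2 * t * k * t = 2 * (k * t ^+ 2) by ring.
move: (k * S) kS => u u1 t2.
have : k * t ^+ 2 * u <= k * t ^+ 2 by rewrite ler_piMr// mulr_ge0// ltW.
lra.
Qed.

Lemma ln_prod e : (forall i, 0 < e i) -> ln (\prod_i e i) = \sum_i ln (e i).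
Proof.
move=> e0; suff [] : 0 < \prod_i e i /\ ln (\prod_i e i) = \sum_i ln (e i) by [].
elim/big_rec2: _ => [|i x y _ [y0 <-]]; first by rewrite ln1.
by rewrite mulr_gt0// lnM// posrE.
Qed.

(** The function [x |-> x / (c + x)] is concave in [ln (1 + x)], as [c <= 1]: it
    lies below its tangent at [mu]. *)
Lemma tangent_bound c mu x : 0 < c <= 1 -> 0 < mu -> 0 <= x ->
  x / (c + x) <= mu / (c + mu) +
    c * (1 + mu) / (c + mu) ^+ 2 * (ln (1 + x) - ln (1 + mu)).
Proof.
move=> /andP[c0 c1] mu0 x0.
have x1 : 0 < 1 + x by rewrite ltr_pwDl.
have mu1 : 0 < 1 + mu by rewrite addr_gt0.
have cx : 0 < c + x by rewrite ltr_wpDr.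
have cmu : 0 < c + mu by rewrite addr_gt0.
have lnr : 1 - (1 + mu) / (1 + x) <= ln (1 + x) - ln (1 + mu).
  have := @le_ln1Dx _ ((1 + mu) / (1 + x) - 1).
  rewrite [1 + (_ - 1)]addrC subrK ln_div ?posrE// ltrBrDr addNr divr_gt0// => /(_ isT).
  lra.
have s0 : 0 <= c * (1 + mu) / (c + mu) ^+ 2.
  by rewrite divr_ge0 ?mulr_ge0 ?exprn_ge0 ?ltW.
apply: le_trans (lerD (lexx _) (ler_wpM2l s0 lnr)).
rewrite -subr_ge0.
have -> : mu / (c + mu) + c * (1 + mu) / (c + mu) ^+ 2 * (1 - (1 + mu) / (1 + x)) -
    x / (c + x) =
    c * (1 - c) * (x - mu) ^+ 2 / ((c + mu) ^+ 2 * (1 + x) * (c + x)).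
  by field; rewrite !gt_eqF.
apply: divr_ge0; last by rewrite ltW// !mulr_gt0// exprn_gt0.
by rewrite mulr_ge0 ?sqr_ge0// mulr_ge0 ?subr_ge0// ltW.
Qed.

(** The product of the [1 + e i] being prescribed and at most [p] of the [e i]
    being nonzero, the sum is largest when [p] of them are equal to
    [v ^ (2 / p) - 1]: sum the tangent bounds at that point, and note that the
    tangent is nonnegative at [0]. *)
Lemma sum_bound (p : nat) (v : R) e : (0 < p)%N -> 1 < v -> v <= 2 ->
  (forall i, 0 <= e i) -> \prod_i (1 + e i) = v ^+ 2 ->
  (#|[pred i | e i != 0%R]| <= p)%N ->
  \sum_i e i / (v - 1 + e i) <= p%:R / (vquot p v + 1).
Proof.
move=> p0 v1 v2 e0 ev Kp; pose c := v - 1; rewrite -/c.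
have c01 : 0 < c <= 1 by rewrite /c; lra.
have pR : 0 < p%:R :> R by rewrite ltr0n.
have v0 : 0 < v by lra.
pose G := v `^ (2 / p%:R); pose mu := G - 1.
have lnG : p%:R * ln G = 2 * ln v by rewrite ln_powR; field; rewrite gt_eqF.
have G0 : 0 < G by rewrite powR_gt0.
have mu0 : 0 < mu.
  have lnv : 0 < ln v by exact: ln_gt0.
  rewrite subr_gt0 -ltr_ln ?posrE// ln1 -(@pmulr_rgt0 _ p%:R)// lnG; lra.
have G1 : 1 + mu = G by rewrite addrC subrK.
have -> : p%:R / (vquot p v + 1) = p%:R * (mu / (c + mu)).
  rewrite /vquot gt_eqF// -/G -/mu -/c; have c0 : 0 < c by case/andP: c01.
  by field; rewrite !gt_eqF// addr_gt0.
pose A := mu / (c + mu); pose s := c * (1 + mu) / (c + mu) ^+ 2; rewrite -/A.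
have tgt x : 0 <= x -> x / (c + x) <= A + s * (ln (1 + x) - ln G).
  by move=> x0; rewrite -G1; exact: tangent_bound.
have A0 : 0 <= A - s * ln G.
  by have := tgt 0 (lexx _); rewrite mul0r addr0 ln1 sub0r mulrN.
rewrite (bigID (fun i => e i != 0))/= [X in _ + X]big1 ?addr0 => [|i]; last first.
  by rewrite negbK => /eqP ->; rewrite mul0r.
apply: (@le_trans _ _ (\sum_(i | e i != 0) ((A - s * ln G) + s * ln (1 + e i)))).
  apply: ler_sum => i _; apply: (le_trans (tgt _ (e0 i))).
  by rewrite le_eqVlt; apply/orP; left; apply/eqP; ring.
rewrite big_split/= sumr_const -mulr_sumr.
have -> : \sum_(i | e i != 0) ln (1 + e i) = 2 * ln v.
  have -> : 2 * ln v = ln (v ^+ 2) by rewrite lnXn// mulr_natl.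
  rewrite -ev ln_prod => [|i]; last by rewrite ltr_pwDl.
  rewrite [RHS](bigID (fun i => e i != 0))/= [X in _ = _ + X]big1 ?addr0// => i.
  by rewrite negbK => /eqP ->; rewrite addr0 ln1.
apply: (@le_trans _ _ ((A - s * ln G) *+ p + s * (2 * ln v))).
  by rewrite lerD2r; apply: ler_wpMn2l.
by rewrite -lnG le_eqVlt -mulr_natl; apply/orP; left; apply/eqP; ring.
Qed.

(** By the Cauchy-Schwarz inequality, [1 + sqrt (e i * e j)] is at most the square
    root of [(1 + e i) * (1 + e j)]. *)
Lemma prod_pair_bound c e i j : 0 <= c -> (forall i, 0 <= e i) ->
  \prod_i (1 + e i) = (1 + c) ^+ 2 -> i != j -> e i * e j <= c ^+ 2.
Proof.
move=> c0 e0 ec ij.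
have : (1 + e i) * (1 + e j) <= (1 + c) ^+ 2.
  rewrite -ec (bigD1 i)//= (bigD1 j) ?(eq_sym j)//= mulrA ler_peMr//.
    by rewrite mulr_ge0// addr_ge0.
  by elim/big_ind: _ => // [x y x1 y1|k _]; [exact: mulr_ege1|rewrite lerDl].
set x := e i; set y := e j => xyc.
have x0 : 0 <= x := e0 i; have y0 : 0 <= y := e0 j.
(* [(1 + al * be) ^ 2 <= (1 + al ^ 2) * (1 + be ^ 2)]. *)
pose al := Num.sqrt x; pose be := Num.sqrt y.
have xE : x = al ^+ 2 by rewrite sqr_sqrtr.
have yE : y = be ^+ 2 by rewrite sqr_sqrtr.
have al0 : 0 <= al := sqrtr_ge0 _; have be0 : 0 <= be := sqrtr_ge0 _.
rewrite xE yE -exprMn ler_pXn2r ?nnegrE ?mulr_ge0// -(lerD2l 1).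
rewrite -(@ler_pXn2r _ 2) ?nnegrE ?addr_ge0 ?mulr_ge0//.
apply: le_trans xyc; rewrite xE yE -subr_ge0.
have -> : (1 + al ^+ 2) * (1 + be ^+ 2) - (1 + al * be) ^+ 2 = (al - be) ^+ 2 by ring.
exact: sqr_ge0.
Qed.

End ScalarInequalities.

(** * Jordan angles *)

Lemma tan_mul_lt1 (R : realType) (x y : R) :
  0 <= x < pi / 2 -> 0 <= y < pi / 2 -> x + y < pi / 2 -> tan x * tan y < 1.
Proof.
move=> /andP[x0 xp] /andP[y0 yp] xy; have pi0 := pi_gt0 R.
have cx : 0 < cos x by apply: cos_gt0_pihalf; apply/andP; split; lra.
have cy : 0 < cos y by apply: cos_gt0_pihalf; apply/andP; split; lra.
have : 0 < cos (x + y) by apply: cos_gt0_pihalf; apply/andP; split; lra.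
rewrite cosD subr_gt0 /tan mulf_div => h.
by rewrite ltr_pdivrMr ?mul1r ?mulr_gt0.
Qed.

(** The nonzero eigenvalues of [Z Z^T] are, with multiplicity, the nonzero squared
    tangents of the Jordan angles, so that two of them at distinct places come from
    two distinct angles. *)
Lemma jordan_pair_bound (R : realType) n m (eps : onbasis R (n + m))
    (P : grassmannian R n m) (e : 'I_n -> R) (i j : 'I_n) :
  B_JX eps P ->
  char_poly (Defs.coord eps P *m (Defs.coord eps P)^T) = \prod_i ('X - (e i)%:P) ->
  i != j -> e i * e j <= 1.
Proof.
move=> [_ [theta [th0 [_ ->]] thp]]; set p := minn n m => cp ij.
pose s (a : 'I_p) := tan (theta a) ^+ 2.
pose t := nseq (n - p) 0 ++ map s (enum 'I_p).
have : perm_eq (map e (enum 'I_n)) t.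
  apply: prod_XsubC_eq; rewrite big_map big_enum /= -cp big_cat/= big_map big_enum/=.
  congr (_ * _); rewrite big_nseq; elim: (n - p)%N => [|k IH]; first by rewrite expr0.
  by rewrite exprS IH /= subr0.
case/(perm_iotaP 0) => Is pIs es.
have sIs : size Is = n by rewrite -(size_enum_ord n) -(size_map e) es size_map.
have eE k : e k = nth 0 t (nth 0%N Is k).
  have := congr1 (fun s => nth 0 s k) es.
  rewrite (nth_map k) ?size_enum_ord// nth_ord_enum => ->.
  by rewrite (nth_map 0%N) ?sIs.
have uIs : uniq Is by rewrite (perm_uniq pIs) iota_uniq.
have {}ij : nth 0%N Is i != nth 0%N Is j by rewrite nth_uniq ?sIs.
have tE k : nth 0 t k = 0 \/ exists2 a : 'I_p, k = (n - p + a)%N & nth 0 t k = s a.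
  rewrite nth_cat size_nseq; case: ltnP => kp; first by rewrite nth_nseq kp; left.
  have [kp'|kp'] := ltnP (k - (n - p)) p; last first.
    by left; rewrite nth_default// size_map size_enum_ord.
  right; exists (Ordinal kp'); first by rewrite /= subnKC.
  by rewrite (nth_map (Ordinal kp')) ?size_enum_ord// (nth_ord_enum _ (Ordinal kp')).
rewrite !eE; have [->|[a ia ->]] := tE (nth 0%N Is i); first by rewrite mul0r.
have [->|[b jb ->]] := tE (nth 0%N Is j); first by rewrite mulr0.
have ab : a != b by apply: contra ij => /eqP ab; rewrite ia jb ab.
have tan0 c : 0 <= tan (theta c).
  have /andP[c0 cp'] := th0 c; have pi0 := pi_gt0 R; rewrite /tan divr_ge0//.
    by apply: sin_ge0_pi; apply/andP; split; lra.
  by apply/ltW/cos_gt0_pihalf; apply/andP; split; lra.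
rewrite /s -exprMn expr_le1//; last exact: mulr_ge0 (tan0 a) (tan0 b).
apply: ltW; apply: tan_mul_lt1 => //; exact: thp.
Qed.

Theorem proposition3p1 (R : realType) (n m : nat) (hn : (0 < n)%N) (hm : (0 < m)%N)
    (eps : onbasis R (n + m)) :
  let p := minn n m in
  convex_on eps (B_JX eps) (v eps) /\
  forall P : grassmannian R n m, U eps P -> v eps P <= 2 ->
  forall X : 'M[R]_(n, m),
    let vP := v eps P in
    Hess eps (v eps) P X X >=
      vP * (2 - vP) * g eps P X X
      + (vquot p vP / (p%:R * vP) + (p%:R + 1) / (p%:R * vP))
        * d eps (v eps) P X ^+ 2.
Proof.
have HessE P X : Hess eps (v eps) P X X = let Z := Defs.coord eps P in
    vol Z * (dlogvol Z X ^+ 2 + metric Z X X +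
             \tr (ginv Z *m X *m Z^T *m ginv Z *m X *m Z^T)).
  by rewrite /Hess v_plane hess_volE -expr2.
split=> [P PJ X|P UP v2 X].
  rewrite HessE; set Z := Defs.coord eps P; cbv zeta.
  have [e [r [[e0 cp _ _] [r0 -> -> rg]]]] := diagonal_form Z X.
  rewrite pmulr_rge0 ?vol_gt0// -addrA addr_ge0 ?sqr_ge0//.
  have h := @diag_le_form _ _ 1 e r ler01 e0.
  have {}h : \sum_i (1 / e i + 1) * r i i ^+ 2 <=
      1 * (\sum_i \sum_j r i j ^+ 2 / e j) + \sum_i \sum_j r i j * r j i.
    by apply: h => // i j ij; rewrite expr1n; exact: jordan_pair_bound PJ cp ij.
  have : 0 <= \sum_i (1 / e i + 1) * r i i ^+ 2.
    by apply: sumr_ge0 => i _; rewrite mulr_ge0 ?sqr_ge0// addr_ge0// divr_ge0.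
  move: h rg; rewrite mul1r; lra.
cbv zeta; set vP := v eps P.
have dE : d eps (v eps) P X = vP * dlogvol (Defs.coord eps P) X.
  rewrite /d v_plane /vP v_coord//.
  by have [_ ->] := is_derive_vol (Defs.coord eps P) X.
rewrite HessE dE /g; have vE : vP = vol (Defs.coord eps P) by exact: v_coord.
have {}v2 : vP <= 2 by [].
rewrite -vE; set Z := Defs.coord eps P; cbv zeta.
have v0 : 0 < vP by rewrite vE vol_gt0.
have [e [r [[e0 _ ev ep] [r0 -> -> rg]]]] := diagonal_form Z X.
rewrite -vE in ev.
have v1 : 1 <= vP.
  rewrite -(@ler_pXn2r _ 2) ?nnegrE ?(ltW v0)// expr1n ev.
  by elim/big_ind: _ => // [x y x1 y1|k _]; [exact: mulr_ege1|rewrite lerDl].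
pose c := vP - 1; have c0 : 0 <= c by rewrite subr_ge0.
set p := minn n m in ep *; have p0 : (0 < p)%N by rewrite leq_min hn hm.
have pR : 0 < p%:R :> R by rewrite ltr0n.
set t := \sum_i r i i; pose k := (vquot p vP + 1) / p%:R.
have hT := @diag_le_form _ _ c e r c0 e0.
have {hT} : \sum_i (c / e i + 1) * r i i ^+ 2 <=
    c * (\sum_i \sum_j r i j ^+ 2 / e j) + \sum_i \sum_j r i j * r j i.
  apply: hT => // i j ij; apply: (prod_pair_bound c0 e0 _ ij).
  by rewrite -ev /c addrCA subrr addr0.
have : k * t ^+ 2 <= \sum_i (c / e i + 1) * r i i ^+ 2.
  (* At [vP = 1] all the eigenvalues vanish, and [t] with them. *)
  have [vP1|vP1] := eqVneq vP 1.
    have e00 i : e i = 0.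
      apply/eqP; rewrite eq_le e0 andbT -(lerD2l 1) addr0.
      have prod1 : \prod_i (1 + e i) = 1 by rewrite -ev vP1 expr1n.
      rewrite -[leRHS]prod1 (bigD1 i)//= ler_peMr ?addr_ge0//.
      by elim/big_ind: _ => // [x y x1 y1|j _]; [exact: mulr_ege1|rewrite lerDl].
    have -> : t = 0 by rewrite /t big1// => i _; exact: r0.
    rewrite expr0n mulr0; apply: sumr_ge0 => i _.
    by rewrite mulr_ge0 ?sqr_ge0// addr_ge0// divr_ge0.
  have vgt1 : 1 < vP by rewrite lt_neqAle eq_sym vP1.
  have q0 : 0 < vquot p vP + 1.
    rewrite /vquot (negbTE vP1) ltr_pwDr// divr_ge0// subr_ge0.
    by rewrite -[leLHS](powRr0 vP) ler_powR// divr_ge0// ltW.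
  apply: weighted_cauchy => //.
  - by rewrite subr_gt0.
  - exact: divr_gt0.
  - by move=> i; exact: r0.
  - have := sum_bound p0 vgt1 v2 e0 (esym ev) ep.
    rewrite -/c /k -ler_pdivlMl ?divr_gt0// mulr1 invf_div//.
move: rg c0; set B := \sum_i \sum_j _ / _; set T := \sum_i \sum_j _.
set M := metric Z X X => BM c0 h1 h2.
have h3 : c * B <= c * M by rewrite ler_wpM2l.
have -> : vP * (2 - vP) * M + (vquot p vP / (p%:R * vP) + (p%:R + 1) / (p%:R * vP)) *
    (vP * t) ^+ 2 = vP * (t ^+ 2 + (1 - c) * M + k * t ^+ 2).
  by rewrite /k /c; field; rewrite !gt_eqF.
rewrite ler_pM2l// mulrBl mul1r; move: h1 h2 h3.
move: (c * B) (c * M) (k * _) (\sum_i _) => x1 x2 x3 x4; lra.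
Qed.
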